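(* Let $M\subset\mathbb{C}^2$ be a real-analytic hypersurface through the origin, graphed near $0$ as \[ v\,=\,F(z,\overline{z},u)\,=\,\sum_{j,k\geqslant 0}z^j\overline{z}^k\,F_{j,k}(u), \] whose coefficient functions satisfy, for all $j,k\geqslant 0$, \[ F_{j,0}(u)\equiv F_{0,k}(u)\equiv 0,\qquad F_{j,1}(u)\equiv 0\ \ (j\neq 1),\qquad F_{1,k}(u)\equiv 0\ \ (k\neq 1),\qquad F_{1,1}(u)\equiv 1,\qquad F_{2,2}(u)\equiv 0. \] If the $u$-axis $\{(z,w)=(0,u)\colon u\in\mathbb{R}\}$, contained in $M$, is a Moser chain of $M$, then \[ F_{3,2}(u)\equiv F_{2,3}(u)\equiv 0. \]
   Context: Coordinates on $\mathbb{C}^2$ are $(z,w)=(x+iy,u+iv)$, with weights $[z]=[\overline{z}]=1$, $[w]=[\overline{w}]=2$, $[u]=2$. $F$ is a real-valued convergent power series in $(z,\overline z,u)$, and $\mathrm{O}(6)$ denotes a convergent power series in $(z,\overline{z},u)$ whose monomials $z^j\overline{z}^ku^l$ all satisfy $j+k+2l\geqslant 6$. Moser chains. Let $M\subset\mathbb{C}^2$ be a real-analytic Levi nondegenerate hypersurface, i.e. $T^cM+[T^cM,T^cM]=TM$ with $T^cM=TM\cap J\,TM$, $J$ the standard complex structure. A curve in $M$ through $q$ is CR-transversal at $q$ if its tangent at $q$ is not in $T^c_qM$; $J^2_{M,q}$ denotes the space of $2$-jets at $q$ of unparametrized curves in $M$ through $q$ which are CR-transversal at $q$. A local biholomorphism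 $\varphi$ sending $(M,q)$ to $(N',q')$ induces a diffeomorphism $\varphi^{(2)}\colon J^2_{M,q}\to J^2_{N',q'}$. A normalizing map of $M$ at $q=(z_q,w_q)$ is a composition $\varphi=\Phi_q\circ\tau_q$, where $\tau_q\colon(z,w)\mapsto(z-z_q,w-w_q)$ and $\Phi_q$ is a local biholomorphism fixing $0$ which sends $\tau_q(M)$ to a hypersurface $N^q$ of equation $v=z\overline{z}+\mathrm{O}(6)$; such maps always exist. On $N^q$, CR-transversal curves through $0$ are graphs $u\mapsto(x(u),y(u))$ in the coordinates $(u,x,y)$ of $N^q$, and $J^2_{N^q,0}\cong\mathbb{R}^4$ has coordinates $(x_1,y_1,x_2,y_2)=(\dot x(0),\dot y(0),\ddot x(0),\ddot y(0))$. Let $\Sigma_0:=\{x_2=-2x_1^2y_1-2y_1^3,\ y_2=2x_1y_1^2+2x_1^3\}\subset J^2_{N^q,0}$ and $\Sigma_q:=(\varphi^{(2)})^{-1}(\Sigma_0)\subset J^2_{M,q}$, which does not depend on the normalizing map $\varphi$. In coordinates $(u,x,y)$ on $M$, the surfaces $\Sigma_q$ are given by two real-analytic equations $x_2=A(u,x,y,x_1,y_1)$, $y_2=B(u,x,y,x_1,y_1)$, and a Moser chain is a solution $u\mapsto(x(u),y(u))$ of the system $\ddot x=A(u,x,y,\dot x,\dot y)$, $\ddot y=B(u,x,y,\dot x,\dot y)$; equivalently, a Moser chain is a real-analytic CR-transversal curve in $M$ whose $2$-jet at each of its points $q$ belongs to $\Sigma_q$. *)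

(* Defs.v *)
From Stdlib Require Import Reals.
From Coquelicot Require Import Coquelicot.
Open Scope R_scope.

(** * Convergent power series *)

(* Multiple series are summed along cubes of indices; every use below is
   accompanied by absolute summability, so the order is immaterial. *)
Definition is_sum2 (a : nat -> nat -> C) (s : C) : Prop :=
  filterlim (fun n => sum_n (fun j => sum_n (fun k => a j k) n) n)
    eventually (locally s).

Definition is_sum3 (a : nat -> nat -> nat -> C) (s : C) : Prop :=
  filterlim
    (fun n => sum_n (fun j => sum_n (fun k => sum_n (fun l => a j k l) n) n) n)
    eventually (locally s).

Definition abs_summable2 (a : nat -> nat -> C) (r : R) : Prop :=
  exists B : R, forall n : nat,
    sum_n (fun j => sum_n (fun k => Cmod (a j k) * r ^ (j + k)) n) n <= B.

Definition abs_summable3 (a : nat -> nat -> nat -> C) (r : R) : Prop :=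
  exists B : R, forall n : nat,
    sum_n (fun j => sum_n (fun k => sum_n (fun l =>
      Cmod (a j k l) * r ^ (j + k + l)) n) n) n <= B.

(* Holomorphy at the origin of C^2: a convergent power series in (z, w). *)
Definition holomorphic_at_0 (f : C * C -> C) : Prop :=
  exists (a : nat -> nat -> C) (r : R),
    0 < r /\ abs_summable2 a r /\
    forall z w : C, Cmod z < r -> Cmod w < r ->
      is_sum2 (fun j k => a j k * Cpow z j * Cpow w k)%C (f (z, w)).

(* [F] is the real-valued function defined on |z| < r, |u| < r by the power
   series  sum_{j,k,l} a_{jkl} z^j zbar^k u^l. *)
Definition power_series_expansion (F : C -> R -> R)
    (a : nat -> nat -> nat -> C) (r : R) : Prop :=
  abs_summable3 a r /\
  forall (z : C) (u : R), Cmod z < r -> Rabs u < r ->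
    is_sum3 (fun j k l =>
      a j k l * Cpow z j * Cpow (Cconj z) k * Cpow (RtoC u) l)%C
      (RtoC (F z u)).

(* The coefficient function F_{j,k}(u) = sum_l a_{jkl} u^l. *)
Definition coef (a : nat -> nat -> nat -> C) (j k : nat) (u : R) : C :=
  (PSeries (fun l => Re (a j k l)) u, PSeries (fun l => Im (a j k l)) u).

(* O(6), for the weights [z] = [zbar] = 1, [u] = 2. *)
Definition O6 (E : C -> R -> R) : Prop :=
  exists (e : nat -> nat -> nat -> C) (r : R),
    0 < r /\ power_series_expansion E e r /\
    forall j k l : nat, e j k l <> RtoC 0 -> (6 <= j + k + 2 * l)%nat.

Definition real_analytic_at (f : R -> R) (t : R) : Prop :=
  exists a : nat -> R, Rbar_lt 0 (CV_radius a) /\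
    locally t (fun s => f s = PSeries a (s - t)).

(** * Hypersurfaces, curves and CR-transversality in C^2 *)

Definition origin : C * C := (RtoC 0, RtoC 0).

Definition graph (F : C -> R -> R) (p : C * C) : Prop :=
  Im (snd p) = F (fst p) (Re (snd p)).

Definition real_analytic_curve_at (c : R -> C * C) (t : R) : Prop :=
  real_analytic_at (fun s => Re (fst (c s))) t /\
  real_analytic_at (fun s => Im (fst (c s))) t /\
  real_analytic_at (fun s => Re (snd (c s))) t /\
  real_analytic_at (fun s => Im (snd (c s))) t.

(* T_q M, as the set of velocities at q of curves contained in M. *)
Definition tangent (M : C * C -> Prop) (q X : C * C) : Prop :=
  exists c : R -> C * C,
    c 0 = q /\ real_analytic_curve_at c 0 /\
    locally 0 (fun t => M (c t)) /\ is_derive c 0 X.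

Definition J (X : C * C) : C * C := (Ci * fst X, Ci * snd X)%C.

(* T^c_q M = T_q M \cap J T_q M *)
Definition complex_tangent (M : C * C -> Prop) (q X : C * C) : Prop :=
  tangent M q X /\ exists Y : C * C, tangent M q Y /\ X = J Y.

Definition CR_transversal_at (M : C * C -> Prop) (c : R -> C * C) (t : R)
    : Prop :=
  exists X : C * C, is_derive c t X /\ ~ complex_tangent M (c t) X.

(** * Normalizing maps *)

Definition local_biholomorphism_fixing_0 (Phi : C * C -> C * C) : Prop :=
  Phi origin = origin /\
  holomorphic_at_0 (fun p => fst (Phi p)) /\
  holomorphic_at_0 (fun p => snd (Phi p)) /\
  exists Psi : C * C -> C * C,
    holomorphic_at_0 (fun p => fst (Psi p)) /\
    holomorphic_at_0 (fun p => snd (Psi p)) /\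
    locally origin (fun p => Psi (Phi p) = p) /\
    locally origin (fun p => Phi (Psi p) = p).

Definition tau (q p : C * C) : C * C := (fst p - fst q, snd p - snd q)%C.

Definition translate (M : C * C -> Prop) (q p : C * C) : Prop :=
  exists m : C * C, M m /\ p = tau q m.

(* v = z zbar + O(6) *)
Definition normal_hypersurface (N : C * C -> Prop) : Prop :=
  exists E : C -> R -> R, O6 E /\
    forall p, N p <-> graph (fun z u => Cmod z ^ 2 + E z u) p.

(* The germ at 0 of Phi (tau_q M) is the germ at 0 of N; as Phi is a local
   homeomorphism at 0, this can be tested at the points Phi p, p near 0. *)
Definition normalizing_map (M : C * C -> Prop) (q : C * C)
    (phi : C * C -> C * C) : Prop :=
  exists (Phi : C * C -> C * C) (N : C * C -> Prop),
    local_biholomorphism_fixing_0 Phi /\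
    normal_hypersurface N /\
    locally origin (fun p => translate M q p <-> N (Phi p)) /\
    forall p, phi p = Phi (tau q p).

(** * Second order jets and Moser chains *)

(* (x1, y1, x2, y2) are the coordinates of the 2-jet at c(t) of the
   unparametrized curve underlying the parametrized curve c: near c(t) the
   projection of this curve to the coordinates (u, x, y) is the graph of
   u |-> (x(u), y(u)). *)
Definition graph_jet2 (c : R -> C * C) (t x1 y1 x2 y2 : R) : Prop :=
  exists x y : R -> R,
    let u := fun s => Re (snd (c s)) in
    ex_derive u t /\ Derive u t <> 0 /\
    real_analytic_at x (u t) /\ real_analytic_at y (u t) /\
    locally t (fun s => fst (c s) = (x (u s), y (u s))) /\
    x1 = Derive x (u t) /\ y1 = Derive y (u t) /\
    x2 = Derive_n x 2 (u t) /\ y2 = Derive_n y 2 (u t).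

Definition Sigma0 (x1 y1 x2 y2 : R) : Prop :=
  x2 = - 2 * x1 ^ 2 * y1 - 2 * y1 ^ 3 /\
  y2 = 2 * x1 * y1 ^ 2 + 2 * x1 ^ 3.

(* The 2-jet of c at q = c(t) belongs to Sigma_q: since phi^(2) sends the
   2-jet of c to that of phi o c, this says that some normalizing map at q
   sends the 2-jet of c into Sigma_0. Sigma_q is independent of phi, and
   normalizing maps exist, so "some" and "every" amount to the same. *)
Definition jet_in_Sigma (M : C * C -> Prop) (c : R -> C * C) (t : R) : Prop :=
  exists phi : C * C -> C * C, normalizing_map M (c t) phi /\
  exists x1 y1 x2 y2 : R,
    graph_jet2 (fun s => phi (c s)) t x1 y1 x2 y2 /\ Sigma0 x1 y1 x2 y2.

(* The curve c, parametrized by the open interval ]a, b[, is a Moser chain. *)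
Definition moser_chain (M : C * C -> Prop) (c : R -> C * C) (a b : R) : Prop :=
  forall t : R, a < t < b ->
    M (c t) /\ real_analytic_curve_at c t /\
    CR_transversal_at M c t /\ jet_in_Sigma M c t.

Definition u_axis (u : R) : C * C := (RtoC 0, RtoC u).

(* Main.v *)
Require Import Defs.
From Stdlib Require Import Reals Lra Lia FunctionalExtensionality.
From Coquelicot Require Import Coquelicot.
Open Scope R_scope.

(** Fix a point q = (0, u0) of the axis, close to the origin, and give z the
weight 1 and w the weight 2. The normalization of the coefficients leaves, for
M translated to q,

  v = z zbar + 2 Re (c z^3 zbar^2) + O(6),    c = F_{3,2}(u0),

so that only the term of weight 5 keeps M from the form v = z zbar + O(6).
Removing it costs a bending of the axis. Indeed let Phi = (f, g) be any
normalizing map. Writing that Phi sends the displayed equation to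
v = z zbar + O(6) and comparing the parts of weight 1, ..., 5 of
Im g = |f|^2 + O(6) gives polynomial relations between the Taylor coefficients
f_jk, g_jk of z^j w^k. They express g_01, f_20, f_30, Re g_02 and
Im (conj f_10 f_11) through f_10, f_01 and f_11, and the weight 5 yields

  |f_10|^2 c = - 4 f_10 conj f_02 + conj f_20 f_30 - 2 i f_20 conj f_11.

The coefficients f_01, f_02, g_01 and Re g_02 are also exactly what determines
the 2-jet of the image of the axis, the curve u |-> Phi (0, u). When this 2-jet
lies in Sigma_0, that is z'' = 2 i z' |z'|^2 in complex notation, the
right-hand side cancels identically ([obstruction_vanishes]). For instance, if
f_01 = 0 then z' = 0, hence z'' = 0 and f_02 = 0, while f_20 = 0 because it is
a multiple of conj f_01: the right-hand side is zero. The general case is the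
same statement composed with an automorphism of the sphere v = z zbar, for
which Sigma_0 consists of the 2-jets of chains.

So F_{3,2} vanishes on a neighbourhood of 0 in the axis, and then identically,
being a power series in u; reality of F gives F_{2,3} = conj F_{3,2}.

The comparison of weights is made along the curves s |-> (s z, s^2 u), s > 0,
for fixed z and u. Along such a curve every function is a polynomial in s of
degree at most 5 plus s^6 times a bounded function; the predicate [jet] records
the six coefficients. The expansions come from tails of absolutely convergent
series ([holomorphic_expansion], [O6_bound], [normalized_expansion]); the parts
of weight i are isolated as coefficients of s^i ([weight_1],
[weights_2_to_5]), and the monomials of one weight are separated by letting z
and u vary ([harmonics_3], [harmonics_4], [harmonics_5]). *)

(** * Tails of multiple power series *)

Lemma C_ext (x y : C) : Re x = Re y -> Im x = Im y -> x = y.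
Proof. destruct x, y; simpl; congruence. Qed.

Lemma Cconj_R (x : R) : Cconj x = RtoC x.
Proof. apply C_ext; simpl; ring. Qed.

Lemma Cmod_sum_n_le (x : nat -> C) (y : nat -> R) (m : R) (n : nat) :
  (forall k, Cmod (x k) <= m * y k) -> Cmod (sum_n x n) <= m * sum_n y n.
Proof.
  intros H; induction n as [|n IH].
  - rewrite !sum_O; apply H.
  - rewrite !sum_Sn; change plus with Cplus at 1.
    change (plus (sum_n y n) (y (S n))) with (sum_n y n + y (S n)).
    eapply Rle_trans; [apply Cmod_triangle|].
    specialize (H (S n)); lra.
Qed.

Lemma sum_n_minus_C (x y : nat -> C) (n : nat) :
  (sum_n x n - sum_n y n)%C = sum_n (fun k => x k - y k)%C n.
Proof.
  induction n as [|n IH].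
  - now rewrite !sum_O.
  - rewrite !sum_Sn, <- IH. change plus with Cplus. ring.
Qed.

Lemma lim_dist_le (X L : nat -> C) (x l : C) (K : R) :
  filterlim X eventually (locally x) -> filterlim L eventually (locally l) ->
  (forall n, Cmod (X n - L n) <= K) -> Cmod (x - l) <= K.
Proof.
  intros HX HL H.
  assert (HD : filterlim (fun n => plus (X n) (opp (L n))) eventually
                 (locally (plus x (opp l)))).
  { refine (filterlim_comp_2 _ _ _ HX _
      (@filterlim_plus _ C_NormedModule x (opp l))).
    exact (filterlim_comp _ _ _ _ _ _ _ _ HL (@filterlim_opp _ C_NormedModule l)). }
  assert (HN : is_lim_seq (fun n => Cmod (X n - L n)) (Finite (Cmod (x - l)))).
  { exact (filterlim_comp _ _ _ _ _ _ _ _ HD (@filterlim_norm _ C_NormedModule _)). }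
  exact (is_lim_seq_le _ _ _ _ H HN (is_lim_seq_const K)).
Qed.

(** Comparison of two multiple series whose terms differ by at most m times
those of a series with bounded partial sums: y will be a truncation of x, m a
power of a small parameter, and b the majorant given by absolute
summability. *)
Lemma sum2_dist_le (x y : nat -> nat -> C) (b : nat -> nat -> R) (s l : C)
  (B m : R) :
  is_sum2 x s -> is_sum2 y l -> 0 <= m ->
  (forall n, sum_n (fun j => sum_n (fun k => b j k) n) n <= B) ->
  (forall j k, Cmod (x j k - y j k) <= m * b j k) ->
  Cmod (s - l) <= m * B.
Proof.
  intros Hx Hy Hm HB H.
  apply (lim_dist_le _ _ _ _ _ Hx Hy); intros n.
  eapply Rle_trans; [|apply Rmult_le_compat_l; [exact Hm|apply (HB n)]].
  rewrite sum_n_minus_C; apply Cmod_sum_n_le; intros j.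
  rewrite sum_n_minus_C; apply Cmod_sum_n_le; intros k; apply H.
Qed.

Lemma sum3_dist_le (x y : nat -> nat -> nat -> C) (b : nat -> nat -> nat -> R)
  (s l : C) (B m : R) :
  is_sum3 x s -> is_sum3 y l -> 0 <= m ->
  (forall n, sum_n (fun i => sum_n (fun j => sum_n (fun k => b i j k) n) n) n
    <= B) ->
  (forall i j k, Cmod (x i j k - y i j k) <= m * b i j k) ->
  Cmod (s - l) <= m * B.
Proof.
  intros Hx Hy Hm HB H.
  apply (lim_dist_le _ _ _ _ _ Hx Hy); intros n.
  eapply Rle_trans; [|apply Rmult_le_compat_l; [exact Hm|apply (HB n)]].
  rewrite sum_n_minus_C; apply Cmod_sum_n_le; intros i.
  rewrite sum_n_minus_C; apply Cmod_sum_n_le; intros j.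
  rewrite sum_n_minus_C; apply Cmod_sum_n_le; intros k; apply H.
Qed.

Lemma pow_le_pow_small (t : R) (m n : nat) :
  0 <= t <= 1 -> (m <= n)%nat -> t ^ n <= t ^ m.
Proof.
  intros Ht Hmn. replace n with (m + (n - m))%nat by lia.
  rewrite pow_add. rewrite <- (Rmult_1_r (t ^ m)) at 2.
  apply Rmult_le_compat_l; [apply pow_le; lra|].
  rewrite <- (pow1 (n - m)). apply pow_incr; lra.
Qed.

Lemma monomial_le (x r t : R) (p j : nat) :
  0 <= x -> x <= r * t ^ p -> x ^ j <= r ^ j * t ^ (p * j).
Proof.
  intros H0 H. rewrite pow_mult, <- Rpow_mult_distr.
  now apply pow_incr.
Qed.

(** In the weighted polydisc |z| <= r t, |w| <= r t^2 a monomial of weight at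
least m gains the factor t^m over its value at |z| = |w| = r. *)
Lemma term2_le (a z w : C) (r t : R) (j k m : nat) :
  0 < r -> 0 <= t <= 1 -> Cmod z <= r * t -> Cmod w <= r * t ^ 2 ->
  (m <= j + 2 * k)%nat ->
  Cmod (a * Cpow z j * Cpow w k)%C <= t ^ m * (Cmod a * r ^ (j + k)).
Proof.
  intros Hr Ht Hz Hw Hm.
  rewrite !Cmod_mult, !Cmod_pow.
  assert (H1 := monomial_le (Cmod z) r t 1 j (Cmod_ge_0 z)
                  ltac:(now rewrite pow_1)).
  assert (H2 := monomial_le (Cmod w) r t 2 k (Cmod_ge_0 w) Hw).
  apply Rle_trans with (Cmod a * (r ^ j * t ^ (1 * j)) * (r ^ k * t ^ (2 * k))).
  - apply Rmult_le_compat; auto using pow_le, Cmod_ge_0, Rmult_le_pos.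
    apply Rmult_le_compat_l; auto using Cmod_ge_0.
  - replace (Cmod a * (r ^ j * t ^ (1 * j)) * (r ^ k * t ^ (2 * k)))
      with (t ^ (j + 2 * k) * (Cmod a * r ^ (j + k)))
      by (rewrite !pow_add, Nat.mul_1_l; ring).
    apply Rmult_le_compat_r.
    + apply Rmult_le_pos; [apply Cmod_ge_0|apply pow_le; lra].
    + now apply pow_le_pow_small.
Qed.

(** The exponent q is the weight given to u: q = 2 for the weights of O(6), while
q = 0 and q = 1 serve for cruder estimates. *)
Lemma term3_le (a z u : C) (r t : R) (q j k l m : nat) :
  0 < r -> 0 <= t <= 1 -> Cmod z <= r * t -> Cmod u <= r * t ^ q ->
  (m <= j + k + q * l)%nat ->
  Cmod (a * Cpow z j * Cpow (Cconj z) k * Cpow u l)%C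
  <= t ^ m * (Cmod a * r ^ (j + k + l)).
Proof.
  intros Hr Ht Hz Hu Hm.
  rewrite !Cmod_mult, !Cmod_pow, Cmod_conj.
  assert (H1 := monomial_le (Cmod z) r t 1 j (Cmod_ge_0 z)
                  ltac:(now rewrite pow_1)).
  assert (H2 := monomial_le (Cmod z) r t 1 k (Cmod_ge_0 z)
                  ltac:(now rewrite pow_1)).
  assert (H3 := monomial_le (Cmod u) r t q l (Cmod_ge_0 u) Hu).
  apply Rle_trans with
    (Cmod a * (r ^ j * t ^ (1 * j)) * (r ^ k * t ^ (1 * k))
       * (r ^ l * t ^ (q * l))).
  - repeat apply Rmult_le_compat;
      auto using pow_le, Cmod_ge_0, Rmult_le_pos, Rle_refl.
  - replace (Cmod a * (r ^ j * t ^ (1 * j)) * (r ^ k * t ^ (1 * k))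
       * (r ^ l * t ^ (q * l)))
      with (t ^ (j + k + q * l) * (Cmod a * r ^ (j + k + l)))
      by (rewrite !pow_add, !Nat.mul_1_l; ring).
    apply Rmult_le_compat_r.
    + apply Rmult_le_pos; [apply Cmod_ge_0|apply pow_le; lra].
    + now apply pow_le_pow_small.
Qed.

Lemma sum_n_stable {G : AbelianMonoid} (x : nat -> G) (m n : nat) :
  (forall k, (m < k)%nat -> x k = zero) -> (m <= n)%nat ->
  sum_n x n = sum_n x m.
Proof.
  intros H Hmn. induction Hmn as [|n Hmn IH]; [reflexivity|].
  rewrite sum_Sn, H by lia. now rewrite plus_zero_r.
Qed.

Lemma sum_n_zero {G : AbelianMonoid} (x : nat -> G) (n : nat) :
  (forall k, x k = zero) -> sum_n x n = zero.
Proof.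
  intros H. rewrite (sum_n_stable x 0 n); [|intros; apply H|lia].
  rewrite sum_O; apply H.
Qed.

Lemma sum_n_single {G : AbelianMonoid} (x : nat -> G) (m n : nat) :
  (forall k, k <> m -> x k = zero) -> (m <= n)%nat -> sum_n x n = x m.
Proof.
  intros H Hmn. rewrite (sum_n_stable x m n); [|intros; apply H; lia|exact Hmn].
  destruct m as [|m]; [apply sum_O|].
  rewrite sum_Sn, (sum_n_ext_loc x (fun _ => zero)).
  - rewrite sum_n_zero by reflexivity. apply plus_zero_l.
  - intros k Hk; apply H; lia.
Qed.

Lemma is_sum2_finite (x : nat -> nat -> C) (m n : nat) :
  (forall j k, (m < j)%nat \/ (n < k)%nat -> x j k = RtoC 0) ->
  is_sum2 x (sum_n (fun j => sum_n (fun k => x j k) n) m).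
Proof.
  intros H.
  refine (filterlim_ext_loc _ _ _ (filterlim_const _)).
  exists (m + n)%nat. intros N HN.
  rewrite (sum_n_stable _ m N).
  - symmetry; apply sum_n_ext; intros j. apply sum_n_stable; [|lia].
    intros k Hk; apply H; auto.
  - intros j Hj. apply sum_n_zero; intros k; apply H; auto.
  - lia.
Qed.

(** The part of weight at most 5 of the series with coefficients c. *)
Definition weighted_poly (c : nat -> nat -> C) (z w : C) : C :=
  (c 0%nat 0%nat + c 1%nat 0%nat * z
   + (c 2%nat 0%nat * (z * z) + c 0%nat 1%nat * w)
   + (c 3%nat 0%nat * (z * z * z) + c 1%nat 1%nat * (z * w))
   + (c 4%nat 0%nat * (z * z * z * z) + c 2%nat 1%nat * (z * z * w)
      + c 0%nat 2%nat * (w * w))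
   + (c 5%nat 0%nat * (z * z * z * z * z) + c 3%nat 1%nat * (z * z * z * w)
      + c 1%nat 2%nat * (z * w * w)))%C.

Lemma holomorphic_expansion (f : C * C -> C) :
  holomorphic_at_0 f ->
  exists (c : nat -> nat -> C) (r B : R), 0 < r /\
    forall z w t, 0 <= t < 1 -> Cmod z <= r * t -> Cmod w <= r * t ^ 2 ->
      Cmod (f (z, w) - weighted_poly c z w) <= t ^ 6 * B.
Proof.
  intros (a & r & Hr & [B HB] & Hf).
  exists a, r, B; split; [exact Hr|].
  intros z w t Ht Hz Hw.
  assert (Ht2 : t ^ 2 <= t).
  { rewrite <- (pow_1 t) at 2. apply pow_le_pow_small; [lra|lia]. }
  assert (Hrt : r * t < r) by nra.
  assert (Hrt2 : r * t ^ 2 < r) by nra.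
  specialize (Hf z w ltac:(lra) ltac:(lra)).
  set (low := fun j k => if Nat.ltb (j + 2 * k) 6
                         then (a j k * Cpow z j * Cpow w k)%C else RtoC 0).
  assert (Hlow : is_sum2 low (weighted_poly a z w)).
  { replace (weighted_poly a z w)
      with (sum_n (fun j => sum_n (fun k => low j k) 2) 5).
    - apply is_sum2_finite. intros j k H. unfold low.
      destruct (Nat.ltb_spec (j + 2 * k) 6); [lia|reflexivity].
    - repeat (rewrite sum_Sn || rewrite sum_O). unfold low; simpl.
      repeat change (@plus _ ?x ?y) with (Cplus x y).
      unfold weighted_poly. ring. }
  refine (sum2_dist_le _ _ _ _ _ _ _ Hf Hlow _ HB _).
  - apply pow_le; lra.
  - intros j k. unfold low. destruct (Nat.ltb_spec (j + 2 * k) 6).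
    + replace (_ - _)%C with (RtoC 0) by ring. rewrite Cmod_0.
      repeat apply Rmult_le_pos; try apply pow_le; try apply Cmod_ge_0; lra.
    + replace (_ - _)%C with (a j k * Cpow z j * Cpow w k)%C by ring.
      apply term2_le; [lra|lra|lra|lra|lia].
Qed.

Lemma is_sum3_zero : is_sum3 (fun _ _ _ => RtoC 0) (RtoC 0).
Proof.
  refine (filterlim_ext _ _ _ (filterlim_const _)). intros n. symmetry.
  refine (sum_n_zero _ n _); intros i.
  refine (sum_n_zero _ n _); intros j.
  now refine (sum_n_zero _ n _).
Qed.

(** The second bound is the expected one. The first holds on the larger domain
|z|, |u| = O(t), where each monomial of weight at least 6 has degree at least
3; it applies to a point of which it is not yet known that u = O(t^2). *)
Lemma O6_bound (E : C -> R -> R) :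
  O6 E -> exists r B, 0 < r /\
    (forall z u t, 0 <= t < 1 -> Cmod z <= r * t -> Rabs u <= r * t ->
      Rabs (E z u) <= t ^ 3 * B) /\
    (forall z u t, 0 <= t < 1 -> Cmod z <= r * t -> Rabs u <= r * t ^ 2 ->
      Rabs (E z u) <= t ^ 6 * B).
Proof.
  intros (e & r & Hr & [[B HB] HE] & He).
  exists r, B; split; [exact Hr|].
  assert (gen : forall (q m : nat) z u t,
    (1 <= q)%nat ->
    (forall j k l, (6 <= j + k + 2 * l -> m <= j + k + q * l)%nat) ->
    0 <= t < 1 -> Cmod z <= r * t -> Rabs u <= r * t ^ q ->
      Rabs (E z u) <= t ^ m * B).
  { intros q m z u t Hq Hqm Ht Hz Hu.
    assert (Htq : t ^ q <= t).
    { rewrite <- (pow_1 t) at 2. apply pow_le_pow_small; [lra|lia]. }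
    assert (Hrt : r * t < r) by nra.
    assert (Hrt2 : r * t ^ q < r) by nra.
    specialize (HE z u ltac:(lra) ltac:(lra)).
    rewrite <- Cmod_R.
    replace (RtoC (E z u)) with (RtoC (E z u) - RtoC 0)%C by ring.
    refine (sum3_dist_le _ _ _ _ _ _ _ HE is_sum3_zero _ HB _).
    - apply pow_le; lra.
    - intros j k l. rewrite <- Cmod_R in Hu.
      destruct (Ceq_dec (e j k l) (RtoC 0)) as [H0|H0].
      + rewrite H0.
        replace (_ - _)%C with (RtoC 0) by ring. rewrite Cmod_0.
        repeat apply Rmult_le_pos; try apply pow_le; try apply Cmod_ge_0; lra.
      + replace (e j k l * _ * _ * _ - RtoC 0)%C
          with (e j k l * Cpow z j * Cpow (Cconj z) k * Cpow u l)%C by ring.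
        apply term3_le with (q := q); [lra|lra|lra|lra|].
        apply Hqm, He, H0. }
  split; intros z u t Ht Hz Hu.
  - apply (gen 1%nat 3%nat); auto; [intros; lia|now rewrite pow_1].
  - apply (gen 2%nat 6%nat); auto.
Qed.

(** * The coefficient functions and the expansion of F *)

Lemma near_0 (r : R) (P : R -> Prop) :
  0 < r -> (forall u, Rabs u < r -> P u) -> locally 0 P.
Proof.
  intros Hr H. exists (mkposreal r Hr). intros u Hu. apply H.
  replace u with (u - 0) by ring. exact Hu.
Qed.

Lemma sum_n_nonneg (x : nat -> R) (n : nat) :
  (forall k, 0 <= x k) -> 0 <= sum_n x n.
Proof.
  intros H; induction n as [|n IH].
  - rewrite sum_O; apply H.
  - rewrite sum_Sn; apply Rplus_le_le_0_compat; auto.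
Qed.

Lemma term_le_sum_n (x : nat -> R) (m n : nat) :
  (forall k, 0 <= x k) -> (m <= n)%nat -> x m <= sum_n x n.
Proof.
  intros H Hmn; induction Hmn as [|n Hmn IH].
  - destruct m as [|m]; [rewrite sum_O; apply Rle_refl|].
    rewrite sum_Sn. pose proof (sum_n_nonneg x m H).
    change (x (S m) <= sum_n x m + x (S m)); lra.
  - rewrite sum_Sn. pose proof (H (S n)).
    change (x m <= sum_n x n + x (S n)); lra.
Qed.

Section Coefficients.

Variables (a : nat -> nat -> nat -> C) (r : R).
Hypotheses (r_pos : 0 < r) (summable : abs_summable3 a r).

Lemma coefficient_bounded :
  exists B, forall j k l, Cmod (a j k l) * r ^ l <= B / r ^ (j + k).
Proof.
  destruct summable as [B HB]. exists B. intros j k l.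
  assert (Hp : 0 < r ^ (j + k)) by now apply pow_lt.
  apply Rmult_le_reg_r with (r ^ (j + k)); [exact Hp|].
  replace (B / r ^ (j + k) * r ^ (j + k)) with B by (field; lra).
  replace (Cmod (a j k l) * r ^ l * r ^ (j + k))
    with (Cmod (a j k l) * r ^ (j + k + l)) by (rewrite pow_add; ring).
  assert (H0 : forall j k l, 0 <= Cmod (a j k l) * r ^ (j + k + l)).
  { intros; apply Rmult_le_pos; [apply Cmod_ge_0|apply pow_le; lra]. }
  eapply Rle_trans; [|apply (HB (j + k + l)%nat)].
  eapply Rle_trans; [|apply (term_le_sum_n (fun j => sum_n _ _) j); [|lia]].
  2: { intros j'; apply sum_n_nonneg; intros; now apply sum_n_nonneg. }
  eapply Rle_trans; [|apply (term_le_sum_n (fun k => sum_n _ _) k); [|lia]].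
  2: { intros k'; now apply sum_n_nonneg. }
  apply (term_le_sum_n (fun l => Cmod (a j k l) * r ^ (j + k + l)) l);
    [auto|lia].
Qed.

(** The map p is the real or the imaginary part. *)
Lemma coef_CV_radius (p : C -> R) (j k : nat) :
  (forall z, Rabs (p z) <= Cmod z) ->
  Rbar_le r (CV_radius (fun l => p (a j k l))).
Proof.
  intros Hp. destruct coefficient_bounded as [B HB].
  apply (CV_radius_bounded (fun l => p (a j k l))).
  exists (B / r ^ (j + k)). intros l.
  rewrite Rabs_mult, (Rabs_pos_eq (r ^ l)) by (apply pow_le; lra).
  eapply Rle_trans; [|apply HB].
  apply Rmult_le_compat_r; [apply pow_le; lra|apply Hp].
Qed.

Lemma im_le_Cmod (z : C) : Rabs (Im z) <= Cmod z.
Proof.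
  eapply Rle_trans; [|apply Rmax_Cmod]. apply Rmax_r.
Qed.

Lemma CV_radius_gt (x : nat -> R) (u : R) :
  Rbar_le r (CV_radius x) -> Rabs u < r -> Rbar_lt (Rabs u) (CV_radius x).
Proof. intros H Hu; eapply Rbar_lt_le_trans; [|exact H]; exact Hu. Qed.

Lemma PSeries_zero_coefficients (x : nat -> R) :
  Rbar_le r (CV_radius x) ->
  locally 0 (fun u => PSeries x u = 0) -> forall l, x l = 0.
Proof.
  intros Hr H l.
  apply (PSeries_ext_recip x (fun _ => 0) l).
  - replace 0 with (Rabs 0) at 1 by apply Rabs_R0.
    apply CV_radius_gt; [exact Hr|rewrite Rabs_R0; exact r_pos].
  - now rewrite CV_radius_const_0.
  - revert H; apply filter_imp; intros u ->. now rewrite PSeries_const_0.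
Qed.

Lemma coef_zero_coefficients (j k : nat) :
  locally 0 (fun u => coef a j k u = RtoC 0) -> forall l, a j k l = RtoC 0.
Proof.
  intros H l. apply C_ext.
  - apply (PSeries_zero_coefficients (fun l => Re (a j k l))).
    + apply coef_CV_radius, re_le_Cmod.
    + revert H; apply filter_imp; intros u Hu.
      exact (f_equal Re Hu).
  - apply (PSeries_zero_coefficients (fun l => Im (a j k l))).
    + apply coef_CV_radius, im_le_Cmod.
    + revert H; apply filter_imp; intros u Hu.
      exact (f_equal Im Hu).
Qed.

Lemma coef_identity_principle (j k : nat) :
  locally 0 (fun u => coef a j k u = RtoC 0) -> forall u, coef a j k u = RtoC 0.
Proof.
  intros H u. pose proof (coef_zero_coefficients j k H) as H0.
  unfold coef.
  rewrite (PSeries_ext _ (fun _ => 0)) by (intros l; now rewrite H0).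
  rewrite (PSeries_ext (fun l => Im _) (fun _ => 0))
    by (intros l; now rewrite H0).
  now rewrite PSeries_const_0.
Qed.

Lemma re_sum_n (x : nat -> C) (n : nat) :
  Re (sum_n x n) = sum_n (fun k => Re (x k)) n.
Proof.
  induction n as [|n IH]; [now rewrite !sum_O|].
  rewrite !sum_Sn, <- IH. reflexivity.
Qed.

Lemma im_sum_n (x : nat -> C) (n : nat) :
  Im (sum_n x n) = sum_n (fun k => Im (x k)) n.
Proof.
  induction n as [|n IH]; [now rewrite !sum_O|].
  rewrite !sum_Sn, <- IH. reflexivity.
Qed.

Lemma is_pseries_coef (x : nat -> R) (u : R) :
  Rbar_le r (CV_radius x) -> Rabs u < r ->
  filterlim (fun n => sum_n (fun l => x l * u ^ l) n) eventually
    (locally (PSeries x u)).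
Proof.
  intros Hx Hu.
  assert (H : is_pseries x u (PSeries x u)).
  { apply PSeries_correct, CV_disk_correct, CV_disk_inside.
    now apply CV_radius_gt. }
  revert H. apply filterlim_ext. intros n. apply sum_n_ext. intros l.
  rewrite pow_n_pow. apply Rmult_comm.
Qed.

Lemma coef_partial_sums (j k : nat) (u : R) :
  Rabs u < r ->
  filterlim (fun n => sum_n (fun l => a j k l * Cpow u l)%C n) eventually
    (locally (coef a j k u)).
Proof.
  intros Hu.
  pose proof (is_pseries_coef _ u (coef_CV_radius Re j k re_le_Cmod) Hu) as H1.
  pose proof (is_pseries_coef _ u (coef_CV_radius Im j k im_le_Cmod) Hu) as H2.
  apply filterlim_locally. intros eps.
  generalize (filter_and _ _ (proj1 (filterlim_locally _ _) H1 eps)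
                (proj1 (filterlim_locally _ _) H2 eps)).
  apply filter_imp. intros n [B1 B2].
  split; [revert B1|revert B2].
  - change (fst (sum_n ?x n)) with (Re (sum_n x n)). rewrite re_sum_n.
    erewrite sum_n_ext; [intros H; exact H|]. intros l.
    cbv beta. rewrite <- RtoC_pow. simpl. unfold Re. ring.
  - change (snd (sum_n ?x n)) with (Im (sum_n x n)). rewrite im_sum_n.
    erewrite sum_n_ext; [intros H; exact H|]. intros l.
    cbv beta. rewrite <- RtoC_pow. simpl. unfold Im. ring.
Qed.

Lemma is_sum3_single (j0 k0 : nat) (z : C) (u : R) :
  Rabs u < r ->
  is_sum3 (fun j k l =>
      if (Nat.eqb j j0 && Nat.eqb k k0)%bool
      then (a j k l * Cpow z j * Cpow (Cconj z) k * Cpow u l)%C else RtoC 0)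
    (coef a j0 k0 u * (Cpow z j0 * Cpow (Cconj z) k0))%C.
Proof.
  intros Hu. set (m := (Cpow z j0 * Cpow (Cconj z) k0)%C).
  assert (H := filterlim_comp _ _ _ _ _ _ _ _ (coef_partial_sums j0 k0 u Hu)
                 (@filterlim_scal_r _ C_NormedModule m (coef a j0 k0 u))).
  replace (coef a j0 k0 u * m)%C with (scal m (coef a j0 k0 u) : C)
    by apply Cmult_comm.
  revert H.
  apply filterlim_ext_loc. exists (j0 + k0)%nat. intros n Hn.
  match goal with |- ?x = _ => set (lhs := x) end.
  rewrite (sum_n_single _ j0 n); [|intros j Hj|lia].
  2: { destruct (Nat.eqb_spec j j0) as [|_]; [contradiction|]. simpl.
       refine (sum_n_zero _ n _); intros k. now refine (sum_n_zero _ n _). }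
  rewrite (sum_n_single _ k0 n); [|intros k Hk|lia].
  2: { destruct (Nat.eqb_spec k k0) as [|_]; [contradiction|].
       rewrite Bool.andb_false_r. now refine (sum_n_zero _ n _). }
  rewrite !Nat.eqb_refl; simpl.
  transitivity (sum_n (fun l => m * (a j0 k0 l * Cpow u l))%C n).
  { symmetry. exact (sum_n_mult_l (K := C_Ring) m _ n). }
  apply sum_n_ext. intros l. unfold m.
  match goal with |- ?x = ?y => change (@eq C x y) end. ring.
Qed.

Lemma is_sum3_plus (x y : nat -> nat -> nat -> C) (s t : C) :
  is_sum3 x s -> is_sum3 y t ->
  is_sum3 (fun j k l => x j k l + y j k l)%C (s + t)%C.
Proof.
  intros Hx Hy.
  generalize (filterlim_comp_2 _ _ _ Hx Hy
                (@filterlim_plus _ C_NormedModule s t)).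
  apply filterlim_ext. intros n.
  rewrite <- (sum_n_plus (G := C_AbelianMonoid)). apply sum_n_ext; intros j.
  rewrite <- (sum_n_plus (G := C_AbelianMonoid)). apply sum_n_ext; intros k.
  now rewrite <- (sum_n_plus (G := C_AbelianMonoid)).
Qed.

(** With h = O(s^2) this makes replacing F_{j,k}(u0 + h) by F_{j,k}(u0), in
front of a monomial of degree 5, an error of weight 7. *)
Lemma coef_lipschitz (j k : nat) (u : R) :
  Rabs u < r ->
  exists K, locally 0 (fun h => Cmod (coef a j k (u + h) - coef a j k u)
    <= K * Rabs h).
Proof.
  intros Hu.
  assert (gen : forall x, Rbar_le r (CV_radius x) ->
    exists K, locally 0 (fun h =>
      Rabs (PSeries x (u + h) - PSeries x u) <= K * Rabs h)).
  { intros x Hx.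
    destruct (ex_derive_PSeries x u (CV_radius_gt x u Hx Hu)) as [d Hd].
    exists (Rabs d + 1).
    destruct Hd as [_ Hd]. specialize (Hd u (fun P H => H) (mkposreal 1 Rlt_0_1)).
    destruct Hd as [e He]. exists e. intros h Hh.
    change R in h.
    assert (E1 : (u + h + - u)%R = h) by ring.
    assert (E2 : (h + - 0)%R = h) by ring.
    assert (Hb : ball u e (u + h)).
    { revert Hh. unfold ball; simpl; unfold AbsRing_ball; simpl.
      unfold minus, plus, opp, abs; simpl.
      rewrite E1, E2. auto. }
    specialize (He (u + h) Hb).
    unfold norm, minus, plus, opp, scal in He; simpl in He;
      unfold abs, mult in He; simpl in He.
    rewrite E1 in He.
    fold (PSeries x (u + h) - PSeries x u) in He.
    replace (PSeries x (u + h) - PSeries x u)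
      with ((PSeries x (u + h) - PSeries x u + - (h * d)) + h * d) by ring.
    eapply Rle_trans; [apply Rabs_triang|]. rewrite (Rabs_mult h d). lra. }
  destruct (gen _ (coef_CV_radius Re j k re_le_Cmod)) as [K1 H1].
  destruct (gen _ (coef_CV_radius Im j k im_le_Cmod)) as [K2 H2].
  exists (K1 + K2). generalize (filter_and _ _ H1 H2).
  apply filter_imp. intros h [B1 B2].
  set (d1 := _ - _) in B1. set (d2 := _ - _) in B2.
  replace (coef a j k (u + h) - coef a j k u)%C with (RtoC d1 + Ci * RtoC d2)%C
    by (apply C_ext; unfold d1, d2; simpl; ring).
  eapply Rle_trans; [apply Cmod_triangle|].
  rewrite Cmod_mult, Cmod_Ci, !Cmod_R. lra.
Qed.

End Coefficients.

Definition quintic (c c' z : C) : C :=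
  (c * (z * z * z * Cconj z * Cconj z)
   + c' * (z * z * Cconj z * Cconj z * Cconj z))%C.

Section Normalized.

Variables (F : C -> R -> R) (a : nat -> nat -> nat -> C) (r : R).
Hypotheses (r_pos : 0 < r) (F_expansion : power_series_expansion F a r).
Hypotheses
  (F_j0 : forall (j : nat) (u : R), Rabs u < r -> coef a j 0 u = RtoC 0)
  (F_0k : forall (k : nat) (u : R), Rabs u < r -> coef a 0 k u = RtoC 0)
  (F_j1 : forall (j : nat) (u : R), j <> 1%nat -> Rabs u < r ->
    coef a j 1 u = RtoC 0)
  (F_1k : forall (k : nat) (u : R), k <> 1%nat -> Rabs u < r ->
    coef a 1 k u = RtoC 0)
  (F_11 : forall u : R, Rabs u < r -> coef a 1 1 u = RtoC 1)
  (F_22 : forall u : R, Rabs u < r -> coef a 2 2 u = RtoC 0).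

(** Below degree 6 in (z, zbar) the normalization kills every pair (j, k) with
j <= 1 or k <= 1, except (1, 1), and also (2, 2); what is left is (3, 2) and
(2, 3). *)
Lemma low_coefficients (j k l : nat) :
  (j + k < 6)%nat -> (j, k) <> (1, 1)%nat -> (j, k) <> (3, 2)%nat ->
  (j, k) <> (2, 3)%nat -> a j k l = RtoC 0.
Proof.
  intros H H11 H32 H23.
  apply (coef_zero_coefficients a r r_pos (proj1 F_expansion)).
  apply (near_0 r); [exact r_pos|]; intros u Hu.
  destruct j as [|[|j]]; [now apply F_0k| |].
  { apply F_1k; [intros ->; now apply H11|exact Hu]. }
  destruct k as [|[|k]]; [now apply F_j0| |].
  { apply F_j1; [discriminate|exact Hu]. }
  assert (Hc : (j = 0 /\ k = 0 \/ j = 0 /\ k = 1 \/ j = 1 /\ k = 0)%nat) by lia.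
  destruct Hc as [[-> ->]|[[-> ->]|[-> ->]]];
    [now apply F_22|now elim H23|now elim H32].
Qed.

(** The variable u is not small compared with r here: it has the weight 0 in this
estimate, and the remainder collects the terms of degree at least 6 in
(z, zbar). *)
Lemma normalized_expansion :
  exists B, forall z u t, 0 <= t < 1 -> Cmod z <= r * t -> Rabs u < r ->
    Cmod (RtoC (F z u)
      - (z * Cconj z + quintic (coef a 3 2 u) (coef a 2 3 u) z)) <= t ^ 6 * B.
Proof.
  destruct F_expansion as [[B HB] HF]. exists B. intros z u t Ht Hz Hu.
  assert (Hrt : r * t < r) by nra.
  specialize (HF z u ltac:(lra) Hu).
  assert (HL := is_sum3_plus _ _ _ _
    (is_sum3_single a r r_pos (proj1 F_expansion) 1 1 z u Hu)
    (is_sum3_plus _ _ _ _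
      (is_sum3_single a r r_pos (proj1 F_expansion) 3 2 z u Hu)
      (is_sum3_single a r r_pos (proj1 F_expansion) 2 3 z u Hu))).
  rewrite F_11 in HL by exact Hu.
  match goal with |- Cmod (_ - ?l) <= _ =>
    match type of HL with is_sum3 _ ?l' =>
      replace l with l' by (unfold quintic; simpl; ring) end end.
  refine (sum3_dist_le _ _ _ _ _ _ _ HF HL _ HB _).
  - apply pow_le; lra.
  - intros j k l. simpl.
    assert (Hpos : 0 <= t ^ 6 * (Cmod (a j k l) * r ^ (j + k + l))).
    { repeat apply Rmult_le_pos; try apply pow_le; try apply Cmod_ge_0; lra. }
    set (x := (a j k l * _ * _ * _)%C).
    assert (Hx : (6 <= j + k)%nat -> Cmod x <=
        t ^ 6 * (Cmod (a j k l) * r ^ (j + k + l))).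
    { intros Hjk. apply term3_le with (q := 0%nat); [lra|lra|exact Hz| |lia].
      rewrite Cmod_R. simpl; lra. }
    assert (Hx0 : a j k l = RtoC 0 -> x = RtoC 0).
    { intros H0. unfold x. rewrite H0. ring. }
    (* Either (j, k) is one of the three retained pairs and the difference is 0,
       or the difference is the whole term x. *)
    destruct (Nat.eqb_spec j 1) as [J1|J1], (Nat.eqb_spec k 1) as [K1|K1],
      (Nat.eqb_spec j 3) as [J3|J3], (Nat.eqb_spec k 2) as [K2|K2],
      (Nat.eqb_spec j 2) as [J2|J2], (Nat.eqb_spec k 3) as [K3|K3];
      try lia; cbn [andb];
      first
      [ match goal with |- Cmod ?d <= _ => replace d with (RtoC 0) by ring end;
        rewrite Cmod_0; exact Hpos
      | match goal with |- Cmod ?d <= _ => replace d with x by ring end;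
        destruct (Nat.le_gt_cases 6 (j + k)) as [Hjk|Hjk];
        [ now apply Hx
        | rewrite Hx0, Cmod_0; [exact Hpos|];
          apply low_coefficients; [exact Hjk|congruence..] ] ].
Qed.

End Normalized.

(** * Jets of order 6 along weighted curves *)

Definition bounded_near_0 (h : R -> C) : Prop :=
  exists K : R, at_right 0 (fun s : R => Cmod (h s) <= K).

Lemma bounded_const (c : C) : bounded_near_0 (fun _ => c).
Proof. exists (Cmod c). apply filter_forall; intros; apply Rle_refl. Qed.

Lemma at_right_pos : at_right 0 (fun s : R => 0 < s).
Proof. exists (mkposreal 1 Rlt_0_1). auto. Qed.

Lemma at_right_small (d : R) : 0 < d -> at_right 0 (fun s : R => 0 < s < d).
Proof.
  intros Hd. exists (mkposreal d Hd). intros s Hs H0; split; [exact H0|].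
  replace s with (s - 0) by apply Rminus_0_r.
  eapply Rle_lt_trans; [apply Rle_abs|]. exact Hs.
Qed.

Lemma bounded_id : bounded_near_0 (fun s => RtoC s).
Proof.
  exists 1. generalize (at_right_small 1 Rlt_0_1). apply filter_imp.
  intros s Hs. rewrite Cmod_R, Rabs_pos_eq; lra.
Qed.

Lemma bounded_plus (h k : R -> C) :
  bounded_near_0 h -> bounded_near_0 k -> bounded_near_0 (fun s => h s + k s)%C.
Proof.
  intros [K HK] [L HL]. exists (K + L). generalize (filter_and _ _ HK HL).
  apply filter_imp. intros s [H1 H2].
  eapply Rle_trans; [apply Cmod_triangle|]; lra.
Qed.

Lemma bounded_mult (h k : R -> C) :
  bounded_near_0 h -> bounded_near_0 k -> bounded_near_0 (fun s => h s * k s)%C.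
Proof.
  intros [K HK] [L HL]. exists (K * L). generalize (filter_and _ _ HK HL).
  apply filter_imp. intros s [H1 H2].
  rewrite Cmod_mult. apply Rmult_le_compat; auto using Cmod_ge_0.
Qed.

Lemma bounded_conj (h : R -> C) :
  bounded_near_0 h -> bounded_near_0 (fun s => Cconj (h s)).
Proof.
  intros [K HK]. exists K. revert HK. apply filter_imp. intros s.
  now rewrite Cmod_conj.
Qed.

Lemma bounded_opp (h : R -> C) :
  bounded_near_0 h -> bounded_near_0 (fun s => - h s)%C.
Proof.
  intros [K HK]. exists K. revert HK. apply filter_imp. intros s.
  now rewrite Cmod_opp.
Qed.

Lemma bounded_pos (h : R -> C) :
  bounded_near_0 h -> exists K, 0 < K /\ at_right 0 (fun s : R => Cmod (h s) <= K).
Proof.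
  intros [K HK]. exists (Rabs K + 1). pose proof (Rabs_pos K).
  split; [lra|]. revert HK. apply filter_imp. intros s H1.
  pose proof (Rle_abs K); lra.
Qed.

Ltac bounded :=
  repeat first [assumption | apply bounded_const | apply bounded_id
               | apply bounded_plus | apply bounded_mult | apply bounded_conj
               | apply bounded_opp].

(** X s = c0 + c1 s + ... + c5 s^5 + O(s^6) as s -> 0+, in Horner form so that
the coefficients can be peeled off one at a time. *)
Definition jet (X : R -> C) (c0 c1 c2 c3 c4 c5 : C) : Prop :=
  exists h, bounded_near_0 h /\ at_right 0 (fun s : R =>
    X s = c0 + s * (c1 + s * (c2 + s * (c3 + s * (c4 + s * (c5 + s * h s)))))
    )%C.

Lemma jet_coefficients (X : R -> C) (c0 c1 c2 c3 c4 c5 d0 d1 d2 d3 d4 d5 : C) :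
  jet X c0 c1 c2 c3 c4 c5 ->
  c0 = d0 -> c1 = d1 -> c2 = d2 -> c3 = d3 -> c4 = d4 -> c5 = d5 ->
  jet X d0 d1 d2 d3 d4 d5.
Proof. now intros H -> -> -> -> -> ->. Qed.

Lemma RtoC_neq_0 (s : R) : 0 < s -> RtoC s <> RtoC 0.
Proof. intros Hs H. apply RtoC_inj in H. lra. Qed.

Lemma jet_of_bound (X Y : R -> C) (c0 c1 c2 c3 c4 c5 : C) (K : R) :
  jet Y c0 c1 c2 c3 c4 c5 ->
  at_right 0 (fun s : R => Cmod (X s - Y s) <= K * s ^ 6) ->
  jet X c0 c1 c2 c3 c4 c5.
Proof.
  intros (h & Hh & E) HK.
  exists (fun s : R => h s + (X s - Y s) / RtoC (s ^ 6))%C. split.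
  - apply bounded_plus; [exact Hh|]. exists K.
    generalize (filter_and _ _ HK at_right_pos). apply filter_imp.
    intros s [H1 H2].
    assert (H6 : 0 < s ^ 6) by now apply pow_lt.
    rewrite Cmod_div by now apply RtoC_neq_0.
    rewrite Cmod_R, (Rabs_pos_eq (s ^ 6)) by lra.
    apply Rle_div_l; lra.
  - generalize (filter_and _ _ E at_right_pos). apply filter_imp.
    intros s [H1 H2]. rewrite RtoC_pow.
    replace (X s) with (Y s + (X s - Y s))%C at 1 by ring. rewrite H1 at 1.
    field. now apply RtoC_neq_0.
Qed.

Lemma jet_conj (X : R -> C) (c0 c1 c2 c3 c4 c5 : C) :
  jet X c0 c1 c2 c3 c4 c5 ->
  jet (fun s : R => Cconj (X s)) (Cconj c0) (Cconj c1) (Cconj c2) (Cconj c3)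
    (Cconj c4) (Cconj c5).
Proof.
  intros (h & Hh & E). exists (fun s : R => Cconj (h s)); split; [bounded|].
  revert E. apply filter_imp. intros s ->.
  rewrite !Cplus_conj, !Cmult_conj, !Cplus_conj, !Cmult_conj, !Cplus_conj,
    !Cmult_conj, !Cplus_conj, !Cmult_conj, !Cplus_conj, !Cmult_conj,
    !Cplus_conj, !Cmult_conj.
  replace (Cconj (RtoC s)) with (RtoC s) by (apply C_ext; simpl; ring).
  reflexivity.
Qed.

Lemma jet_plus (X Y : R -> C) (c0 c1 c2 c3 c4 c5 d0 d1 d2 d3 d4 d5 : C) :
  jet X c0 c1 c2 c3 c4 c5 -> jet Y d0 d1 d2 d3 d4 d5 ->
  jet (fun s : R => X s + Y s)%C (c0 + d0) (c1 + d1) (c2 + d2) (c3 + d3) (c4 + d4)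
    (c5 + d5).
Proof.
  intros (h & Hh & E) (k & Hk & E').
  exists (fun s : R => h s + k s)%C; split; [bounded|].
  generalize (filter_and _ _ E E'). apply filter_imp. intros s [-> ->]. ring.
Qed.

(** The bounded function in the remainder is the part of degree at least 6 of
the product, divided by s^6. *)
Lemma jet_mult (X Y : R -> C) (c0 c1 c2 c3 c4 c5 d0 d1 d2 d3 d4 d5 : C) :
  jet X c0 c1 c2 c3 c4 c5 -> jet Y d0 d1 d2 d3 d4 d5 ->
  jet (fun s : R => X s * Y s)%C (c0 * d0) (c0 * d1 + c1 * d0)
    (c0 * d2 + c1 * d1 + c2 * d0)
    (c0 * d3 + c1 * d2 + c2 * d1 + c3 * d0)
    (c0 * d4 + c1 * d3 + c2 * d2 + c3 * d1 + c4 * d0)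
    (c0 * d5 + c1 * d4 + c2 * d3 + c3 * d2 + c4 * d1 + c5 * d0).
Proof.
  intros (h & Hh & E) (k & Hk & E').
  exists (fun s : R =>
    (c1 * d5 + c2 * d4 + c3 * d3 + c4 * d2 + c5 * d1)
    + s * ((c2 * d5 + c3 * d4 + c4 * d3 + c5 * d2)
    + s * ((c3 * d5 + c4 * d4 + c5 * d3)
    + s * ((c4 * d5 + c5 * d4) + s * (c5 * d5))))
    + h s * (d0 + s * (d1 + s * (d2 + s * (d3 + s * (d4 + s * (d5 + s * k s))))))
    + (c0 + s * (c1 + s * (c2 + s * (c3 + s * (c4 + s * c5))))) * k s)%C.
  split; [bounded|].
  generalize (filter_and _ _ E E'). apply filter_imp. intros s [-> ->]. ring.
Qed.

Lemma jet_const (c : C) : jet (fun _ => c) c 0 0 0 0 0.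
Proof.
  exists (fun _ => RtoC 0); split; [bounded|].
  apply filter_forall; intros s; ring.
Qed.

Lemma jet_opp (X : R -> C) (c0 c1 c2 c3 c4 c5 : C) :
  jet X c0 c1 c2 c3 c4 c5 ->
  jet (fun s : R => - X s)%C (- c0) (- c1) (- c2) (- c3) (- c4) (- c5).
Proof.
  intros (h & Hh & E). exists (fun s : R => - h s)%C; split; [bounded|].
  revert E. apply filter_imp. intros s ->. ring.
Qed.

(** As s -> 0+ the product s * h s tends to 0, which forces c = 0; dividing by s
then gives the second part. *)
Lemma leading_term_zero (c : C) (h : R -> C) :
  bounded_near_0 h -> at_right 0 (fun s : R => c + s * h s = 0)%C ->
  c = RtoC 0 /\ at_right 0 (fun s : R => h s = RtoC 0).
Proof.
  intros Hh E.
  assert (Hc : c = RtoC 0).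
  { destruct (bounded_pos h Hh) as [K [HK0 HK]].
    destruct (Ceq_dec c (RtoC 0)) as [|Hc]; [assumption|exfalso].
    apply Cmod_gt_0 in Hc.
    assert (Hd : 0 < Cmod c / K) by now apply Rdiv_lt_0_compat.
    destruct (filter_ex _ (filter_and _ _ (filter_and _ _ HK E)
                             (at_right_small _ Hd))) as [s [[H1 H2] H3]].
    assert (H4 : Cmod c = s * Cmod (h s)).
    { replace c with (- (RtoC s * h s))%C.
      - rewrite Cmod_opp, Cmod_mult, Cmod_R, Rabs_pos_eq; lra.
      - replace (- (RtoC s * h s))%C with (c - (c + RtoC s * h s))%C by ring.
        rewrite H2. ring. }
    destruct H3 as [H3 H5]. apply Rlt_div_r in H5; [|exact HK0].
    pose proof (Cmod_ge_0 (h s)). nra. }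
  split; [exact Hc|]. generalize (filter_and _ _ E at_right_pos).
  apply filter_imp. intros s [H1 H2]. rewrite Hc, Cplus_0_l in H1.
  replace (h s) with (/ s * (s * h s))%C
    by (field; now apply RtoC_neq_0).
  rewrite H1. ring.
Qed.

Lemma jet_zero (X : R -> C) (c0 c1 c2 c3 c4 c5 : C) :
  jet X c0 c1 c2 c3 c4 c5 -> at_right 0 (fun s : R => X s = RtoC 0) ->
  c0 = RtoC 0 /\ c1 = RtoC 0 /\ c2 = RtoC 0 /\ c3 = RtoC 0 /\ c4 = RtoC 0
  /\ c5 = RtoC 0.
Proof.
  intros (h & Hh & E) E0.
  assert (E1 : at_right 0 (fun s : R =>
    c0 + s * (c1 + s * (c2 + s * (c3 + s * (c4 + s * (c5 + s * h s))))) = 0)%C).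
  { generalize (filter_and _ _ E E0). apply filter_imp. intros s [<- H]; exact H. }
  apply leading_term_zero in E1 as [-> E1]; [|bounded].
  apply leading_term_zero in E1 as [-> E1]; [|bounded].
  apply leading_term_zero in E1 as [-> E1]; [|bounded].
  apply leading_term_zero in E1 as [-> E1]; [|bounded].
  apply leading_term_zero in E1 as [-> E1]; [|bounded].
  apply leading_term_zero in E1 as [-> E1]; [|bounded].
  auto 10.
Qed.

Lemma jet_negligible (X : R -> C) (c0 c1 c2 c3 c4 c5 : C) (K : R) :
  jet X c0 c1 c2 c3 c4 c5 -> at_right 0 (fun s : R => Cmod (X s) <= K * s ^ 6) ->
  c0 = RtoC 0 /\ c1 = RtoC 0 /\ c2 = RtoC 0 /\ c3 = RtoC 0 /\ c4 = RtoC 0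
  /\ c5 = RtoC 0.
Proof.
  intros HX HK.
  apply (jet_zero (fun _ => RtoC 0)); [|now apply filter_forall].
  apply (jet_of_bound _ X _ _ _ _ _ _ K HX). revert HK. apply filter_imp.
  intros s. replace (0 - X s)%C with (- X s)%C by ring. now rewrite Cmod_opp.
Qed.

Lemma jet_unique (X : R -> C) (c0 c1 c2 c3 c4 c5 d0 d1 d2 d3 d4 d5 : C) :
  jet X c0 c1 c2 c3 c4 c5 -> jet X d0 d1 d2 d3 d4 d5 ->
  c0 = d0 /\ c1 = d1 /\ c2 = d2 /\ c3 = d3 /\ c4 = d4 /\ c5 = d5.
Proof.
  intros H1 H2.
  assert (H : forall c d : C, (c + - d)%C = RtoC 0 -> c = d).
  { intros c d H. replace c with (c + - d + d)%C by ring. rewrite H. ring. }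
  destruct (jet_zero _ _ _ _ _ _ _ (jet_plus _ _ _ _ _ _ _ _ _ _ _ _ _ _ H1
              (jet_opp _ _ _ _ _ _ _ H2))) as (?&?&?&?&?&?).
  - apply filter_forall; intros; ring.
  - repeat split; now apply H.
Qed.

Lemma jet_ext (X Y : R -> C) (c0 c1 c2 c3 c4 c5 : C) :
  at_right 0 (fun s : R => X s = Y s) ->
  jet X c0 c1 c2 c3 c4 c5 -> jet Y c0 c1 c2 c3 c4 c5.
Proof.
  intros E (h & Hh & E'). exists h; split; [exact Hh|].
  generalize (filter_and _ _ E E'). apply filter_imp. now intros s [<- ->].
Qed.

Lemma jet_bound_1 (X : R -> C) (c1 c2 c3 c4 c5 : C) :
  jet X 0 c1 c2 c3 c4 c5 ->
  exists K, 0 < K /\ at_right 0 (fun s : R => Cmod (X s) <= K * s).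
Proof.
  intros (h & Hh & E).
  destruct (bounded_pos (fun s : R =>
    c1 + s * (c2 + s * (c3 + s * (c4 + s * (c5 + s * h s)))))%C) as [K [HK H]];
    [bounded|].
  exists K; split; [exact HK|].
  generalize (filter_and _ _ (filter_and _ _ E H) at_right_pos).
  apply filter_imp. intros s [[-> H1] H2].
  rewrite Cplus_0_l, Cmod_mult, Cmod_R, Rabs_pos_eq by lra. nra.
Qed.

Lemma jet_bound_2 (X : R -> C) (c2 c3 c4 c5 : C) :
  jet X 0 0 c2 c3 c4 c5 ->
  exists K, 0 < K /\ at_right 0 (fun s : R => Cmod (X s) <= K * s ^ 2).
Proof.
  intros (h & Hh & E).
  destruct (bounded_pos (fun s : R =>
    c2 + s * (c3 + s * (c4 + s * (c5 + s * h s))))%C) as [K [HK H]];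
    [bounded|].
  exists K; split; [exact HK|].
  generalize (filter_and _ _ (filter_and _ _ E H) at_right_pos).
  apply filter_imp. intros s [[-> H1] H2].
  rewrite !Cplus_0_l, !Cmod_mult, Cmod_R, Rabs_pos_eq by lra.
  assert (0 < s * s) by nra. nra.
Qed.

(** [part2], ..., [part5] are the coefficients of s^2, ..., s^5 in f (s z, W)
when f has Taylor coefficients c and W = s^2 w + s^5 y + O(s^6). The correction
y enters for the first time in [part5], through the linear term in w. *)
Definition part2 (c : nat -> nat -> C) (z w : C) : C :=
  (c 2%nat 0%nat * (z * z) + c 0%nat 1%nat * w)%C.
Definition part3 (c : nat -> nat -> C) (z w : C) : C :=
  (c 3%nat 0%nat * (z * z * z) + c 1%nat 1%nat * (z * w))%C.
Definition part4 (c : nat -> nat -> C) (z w : C) : C :=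
  (c 4%nat 0%nat * (z * z * z * z) + c 2%nat 1%nat * (z * z * w)
   + c 0%nat 2%nat * (w * w))%C.
Definition part5 (c : nat -> nat -> C) (z w y : C) : C :=
  (c 5%nat 0%nat * (z * z * z * z * z) + c 3%nat 1%nat * (z * z * z * w)
   + c 1%nat 2%nat * (z * w * w) + c 0%nat 1%nat * y)%C.

Lemma jet_weighted_poly (c : nat -> nat -> C) (zeta omega eta : C)
  (w : R -> C) :
  jet w 0 0 omega 0 0 eta ->
  jet (fun s : R => weighted_poly c (s * zeta) (w s)) (c 0%nat 0%nat)
    (c 1%nat 0%nat * zeta) (part2 c zeta omega) (part3 c zeta omega)
    (part4 c zeta omega) (part5 c zeta omega eta).
Proof.
  intros (h & Hh & E).
  exists (fun s : R => let y := (eta + s * h s)%C in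
    c 0%nat 1%nat * h s + c 1%nat 1%nat * zeta * y
    + c 2%nat 1%nat * (zeta * zeta) * (s * y)
    + c 3%nat 1%nat * (zeta * zeta * zeta) * (s * s * y)
    + c 0%nat 2%nat * (s * ((omega + omega) * y + s * s * s * y * y))
    + c 1%nat 2%nat * zeta * (s * s * ((omega + omega) * y + s * s * s * y * y))
    )%C.
  split; [cbv zeta; bounded|].
  revert E. apply filter_imp. intros s ->.
  unfold weighted_poly, part2, part3, part4, part5. ring.
Qed.

(** Chooses the weighted polydisc of parameter t = k s that contains all points
with |z| <= x s and |w| <= y s^2. *)
Lemma scaling_factor (x y r : R) :
  0 < r -> 0 <= x -> 0 <= y ->
  exists k, 1 <= k /\ x <= r * k /\ y <= r * k ^ 2.
Proof.
  intros Hr Hx Hy. exists (1 + x / r + y / r).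
  assert (0 <= x / r) by (apply Rdiv_le_0_compat; lra).
  assert (0 <= y / r) by (apply Rdiv_le_0_compat; lra).
  assert (Ex : r * (x / r) = x) by (field; lra).
  assert (Ey : r * (y / r) = y) by (field; lra).
  set (p := x / r) in *. set (q := y / r) in *.
  split; [lra|]. split; [nra|].
  assert (1 + p + q <= (1 + p + q) ^ 2) by nra. nra.
Qed.

Lemma holomorphic_jet (f : C * C -> C) (c : nat -> nat -> C) (r B : R)
  (zeta omega eta : C) (w : R -> C) :
  0 < r ->
  (forall z w t, 0 <= t < 1 -> Cmod z <= r * t -> Cmod w <= r * t ^ 2 ->
     Cmod (f (z, w) - weighted_poly c z w) <= t ^ 6 * B) ->
  jet w 0 0 omega 0 0 eta ->
  jet (fun s : R => f (s * zeta, w s)%C) (c 0%nat 0%nat)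
    (c 1%nat 0%nat * zeta) (part2 c zeta omega) (part3 c zeta omega)
    (part4 c zeta omega) (part5 c zeta omega eta).
Proof.
  intros Hr Hf Hw.
  destruct (jet_bound_2 _ _ _ _ _ Hw) as [W [HW0 HW]].
  destruct (scaling_factor (Cmod zeta) W r Hr (Cmod_ge_0 _)) as (k & Hk & Hz & Hy);
    [lra|].
  apply (jet_of_bound _ _ _ _ _ _ _ _ (k ^ 6 * B)
           (jet_weighted_poly c zeta omega eta w Hw)).
  assert (Hd : 0 < / k) by (apply Rinv_0_lt_compat; lra).
  generalize (filter_and _ _ HW (at_right_small _ Hd)). apply filter_imp.
  intros s [H1 [H2 H3]].
  assert (Hks : k * s < 1).
  { apply (Rmult_lt_compat_l k) in H3; [|lra].
    rewrite Rinv_r in H3; lra. }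
  replace (k ^ 6 * B * s ^ 6) with ((k * s) ^ 6 * B) by ring.
  apply Hf.
  - split; [nra|exact Hks].
  - rewrite Cmod_mult, Cmod_R, Rabs_pos_eq by lra. nra.
  - eapply Rle_trans; [exact H1|]. assert (0 < s ^ 2) by nra.
    replace (r * (k * s) ^ 2) with (r * k ^ 2 * s ^ 2) by ring. nra.
Qed.

(** * Weights in the equation Im g = |f|^2 + O(6) *)

Lemma im_defect (x y : C) (e : R) :
  Im x = Cmod y ^ 2 + e ->
  (x + - Cconj x + - (2 * Ci * (y * Cconj y)))%C = (2 * Ci * RtoC e)%C.
Proof.
  intros H. rewrite <- Cmod2_conj.
  replace (x + - Cconj x)%C with (x - Cconj x)%C by ring.
  rewrite im_alt', H, RtoC_plus, !RtoC_pow. ring.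
Qed.

Lemma Cmod_2Ci (e : R) : Cmod (2 * Ci * RtoC e) = 2 * Rabs e.
Proof. rewrite !Cmod_mult, Cmod_Ci, !Cmod_R, (Rabs_pos_eq 2) by lra. ring. Qed.

(** The defect is 2 i (Im G - |X|^2). Its coefficient of s^i is the difference
of the two sides of the relation of weight i. *)
Lemma jet_im_defect (G X : R -> C) (b1 b2 b3 b4 b5 a1 a2 a3 a4 a5 : C) :
  jet G 0 b1 b2 b3 b4 b5 -> jet X 0 a1 a2 a3 a4 a5 ->
  exists d0, jet (fun s : R =>
      G s + - Cconj (G s) + - (2 * Ci * (X s * Cconj (X s))))%C d0
    (b1 - Cconj b1)
    (b2 - Cconj b2 - 2 * Ci * (a1 * Cconj a1))
    (b3 - Cconj b3 - 2 * Ci * (a1 * Cconj a2 + a2 * Cconj a1))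
    (b4 - Cconj b4 - 2 * Ci * (a1 * Cconj a3 + a2 * Cconj a2 + a3 * Cconj a1))
    (b5 - Cconj b5 - 2 * Ci * (a1 * Cconj a4 + a2 * Cconj a3 + a3 * Cconj a2
                               + a4 * Cconj a1)).
Proof.
  intros HG HX.
  pose proof (jet_plus _ _ _ _ _ _ _ _ _ _ _ _ _ _
    (jet_plus _ _ _ _ _ _ _ _ _ _ _ _ _ _ HG
       (jet_opp _ _ _ _ _ _ _ (jet_conj _ _ _ _ _ _ _ HG)))
    (jet_opp _ _ _ _ _ _ _ (jet_mult _ _ _ _ _ _ _ _ _ _ _ _ _ _
       (jet_const (2 * Ci))
       (jet_mult _ _ _ _ _ _ _ _ _ _ _ _ _ _ HX
          (jet_conj _ _ _ _ _ _ _ HX))))) as H.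
  match type of H with jet _ ?d _ _ _ _ _ => exists d end.
  assert (E0 : Cconj 0 = RtoC 0) by (apply C_ext; simpl; ring).
  apply (jet_coefficients _ _ _ _ _ _ _ _ _ _ _ _ _ H); rewrite ?E0; ring.
Qed.

Lemma Cminus_eq_0 (x y : C) : (x - y)%C = RtoC 0 -> x = y.
Proof. intros H. replace x with (x - y + y)%C by ring. rewrite H. ring. Qed.

(** The coefficient b1 is not yet known to vanish, so Re G is only O(s) and E is
only known to be O(s^3); this is enough for the weight 1. *)
Lemma weight_1 (G X : R -> C) (E : C -> R -> R) (b1 b2 b3 b4 b5 a1 a2 a3 a4 a5 : C) :
  jet G 0 b1 b2 b3 b4 b5 -> jet X 0 a1 a2 a3 a4 a5 -> O6 E ->
  at_right 0 (fun s => Im (G s) = Cmod (X s) ^ 2 + E (X s) (Re (G s))) ->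
  b1 = Cconj b1.
Proof.
  intros HG HX HE Heq.
  destruct (O6_bound E HE) as (r & B & Hr & HB & _).
  destruct (jet_bound_1 _ _ _ _ _ _ HG) as [KG [HKG0 HKG]].
  destruct (jet_bound_1 _ _ _ _ _ _ HX) as [KX [HKX0 HKX]].
  destruct (scaling_factor KX KG r Hr) as (k & Hk & HkX & HkG); [lra|lra|].
  destruct (jet_im_defect _ _ _ _ _ _ _ _ _ _ _ _ HG HX) as [d0 HD].
  (* The defect is O(s^3); multiplied by s^3 it becomes negligible. *)
  assert (Hs3 : jet (fun s : R => s * s * s)%C 0 0 0 1 0 0).
  { exists (fun _ => RtoC 0); split; [bounded|].
    apply filter_forall; intros; ring. }
  pose proof (jet_mult _ _ _ _ _ _ _ _ _ _ _ _ _ _ HD Hs3) as HD3.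
  apply (jet_negligible _ _ _ _ _ _ _ (2 * (k ^ 6 * B))) in HD3.
  - destruct HD3 as (_ & _ & _ & _ & H4 & _).
    apply Cminus_eq_0. etransitivity; [|exact H4]. ring.
  - assert (Hd : 0 < / (k ^ 2)) by (apply Rinv_0_lt_compat, pow_lt; lra).
    generalize (filter_and _ _ (filter_and _ _ HKG HKX)
                  (filter_and _ _ Heq (at_right_small _ Hd))).
    apply filter_imp. intros s [[H1 H2] [H3 [H4 H5]]].
    assert (Hk2 : 0 < k ^ 2) by (apply pow_lt; lra).
    assert (Hks : k ^ 2 * s < 1).
    { apply (Rmult_lt_compat_l (k ^ 2)) in H5; [|exact Hk2].
      rewrite Rinv_r in H5; lra. }
    rewrite (im_defect _ _ _ H3), Cmod_mult, Cmod_2Ci, !Cmod_mult, Cmod_R,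
      (Rabs_pos_eq s) by lra.
    replace (2 * (k ^ 6 * B) * s ^ 6)
      with (2 * ((k ^ 2 * s) ^ 3 * B) * (s * s * s)) by ring.
    apply Rmult_le_compat_r; [assert (0 < s * s) by nra; nra|].
    apply Rmult_le_compat_l; [lra|]. apply HB.
    + nra.
    + eapply Rle_trans; [exact H2|].
      assert (k <= k ^ 2) by nra.
      assert (r * k <= r * k ^ 2) by nra.
      replace (r * (k ^ 2 * s)) with (r * k ^ 2 * s) by ring. nra.
    + eapply Rle_trans; [apply re_le_Cmod|]. eapply Rle_trans; [exact H1|].
      replace (r * (k ^ 2 * s)) with (r * k ^ 2 * s) by ring. nra.
Qed.

(** Here b1 = 0, so Re G = O(s^2) and E = O(s^6) is invisible up to weight 5. *)
Lemma weights_2_to_5 (G X : R -> C) (E : C -> R -> R)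
  (b2 b3 b4 b5 a1 a2 a3 a4 a5 : C) :
  jet G 0 0 b2 b3 b4 b5 -> jet X 0 a1 a2 a3 a4 a5 -> O6 E ->
  at_right 0 (fun s => Im (G s) = Cmod (X s) ^ 2 + E (X s) (Re (G s))) ->
  (b2 - Cconj b2 = 2 * Ci * (a1 * Cconj a1))%C /\
  (b3 - Cconj b3 = 2 * Ci * (a1 * Cconj a2 + a2 * Cconj a1))%C /\
  (b4 - Cconj b4
   = 2 * Ci * (a1 * Cconj a3 + a2 * Cconj a2 + a3 * Cconj a1))%C /\
  (b5 - Cconj b5
   = 2 * Ci * (a1 * Cconj a4 + a2 * Cconj a3 + a3 * Cconj a2
               + a4 * Cconj a1))%C.
Proof.
  intros HG HX HE Heq.
  destruct (O6_bound E HE) as (r & B & Hr & _ & HB).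
  destruct (jet_bound_2 _ _ _ _ _ HG) as [KG [HKG0 HKG]].
  destruct (jet_bound_1 _ _ _ _ _ _ HX) as [KX [HKX0 HKX]].
  destruct (scaling_factor KX KG r Hr) as (k & Hk & HkX & HkG); [lra|lra|].
  destruct (jet_im_defect _ _ _ _ _ _ _ _ _ _ _ _ HG HX) as [d0 HD].
  apply (jet_negligible _ _ _ _ _ _ _ (2 * (k ^ 6 * B))) in HD.
  - destruct HD as (_ & _ & H2 & H3 & H4 & H5).
    repeat split; now apply Cminus_eq_0.
  - assert (Hd : 0 < / k) by (apply Rinv_0_lt_compat; lra).
    generalize (filter_and _ _ (filter_and _ _ HKG HKX)
                  (filter_and _ _ Heq (at_right_small _ Hd))).
    apply filter_imp. intros s [[H1 H2] [H3 [H4 H5]]].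
    assert (Hks : k * s < 1).
    { apply (Rmult_lt_compat_l k) in H5; [|lra].
      rewrite Rinv_r in H5; lra. }
    rewrite (im_defect _ _ _ H3), Cmod_2Ci.
    replace (2 * (k ^ 6 * B) * s ^ 6) with (2 * ((k * s) ^ 6 * B)) by ring.
    apply Rmult_le_compat_l; [lra|]. apply HB.
    + nra.
    + eapply Rle_trans; [exact H2|].
      replace (r * (k * s)) with (r * k * s) by ring. nra.
    + eapply Rle_trans; [apply re_le_Cmod|]. eapply Rle_trans; [exact H1|].
      assert (0 < s ^ 2) by (apply pow_lt; lra).
      replace (r * (k * s) ^ 2) with (r * k ^ 2 * s ^ 2) by ring. nra.
Qed.

(** * Relations between the Taylor coefficients of a normalizing map *)

(** In this lemma and the next two, a polynomial in (z, zbar, u), homogeneous for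
the weights, has zero real part, and the coefficients of interest must vanish.
Write z = rho e^{i theta}: the monomials of given degree in u are distinguished
by their frequency in theta, of absolute value at most 5. The points 1, i,
1 + i, 1 - i are, up to scaling, half of the eighth roots of unity, the other
half being reached by parity; the values there separate the frequencies needed,
and two or three values of u separate the powers of u. *)
Lemma harmonics_3 (A B D : C) :
  (forall (z : C) (u : R),
     Re (A * (z * u) + B * (z * z * Cconj z) + D * (z * z * z))%C = 0) ->
  A = RtoC 0 /\ B = RtoC 0.
Proof.
  intros H. destruct A as [A1 A2], B as [B1 B2], D as [D1 D2].
  pose proof (H (1, 0) 0) as E1. pose proof (H (1, 0) 1) as E2.
  pose proof (H (0, 1) 0) as E3. pose proof (H (0, 1) 1) as E4.
  pose proof (H (1, 1) 0) as E5. pose proof (H (1, -1) 0) as E6.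
  simpl in *. split; apply C_ext; simpl; lra.
Qed.

Lemma harmonics_4 (A B D a b d : C) :
  (forall (z : C) (u : R),
     Re (A * (z * z * u) + B * (z * z * z * Cconj z) + D * (z * z * z * z)
         + a * (u * u) + b * (u * (z * Cconj z))
         + d * (z * Cconj z * (z * Cconj z)))%C = 0) ->
  A = RtoC 0 /\ B = RtoC 0 /\ Re a = 0 /\ Re b = 0 /\ Re d = 0.
Proof.
  intros H. destruct A as [A1 A2], B as [B1 B2], D as [D1 D2],
    a as [a1 a2], b as [b1 b2], d as [d1 d2].
  pose proof (H (0, 0) 1) as E0.
  pose proof (H (1, 0) 0) as E1. pose proof (H (1, 0) 1) as E2.
  pose proof (H (0, 1) 0) as E3. pose proof (H (0, 1) 1) as E4.
  pose proof (H (1, 1) 0) as E5. pose proof (H (1, 1) 1) as E6.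
  pose proof (H (1, -1) 0) as E7. pose proof (H (1, -1) 1) as E8.
  simpl in *. repeat split; try (apply C_ext; simpl); lra.
Qed.

Lemma harmonics_5 (A B D E G K : C) :
  (forall (z : C) (u : R),
     Re (A * (z * u * u) + B * (z * z * Cconj z * u)
         + D * (z * z * z * Cconj z * Cconj z)
         + E * (z * z * z * u) + G * (z * z * z * z * Cconj z)
         + K * (z * z * z * z * z))%C = 0) ->
  A = RtoC 0 /\ B = RtoC 0 /\ D = RtoC 0.
Proof.
  intros H. destruct A as [A1 A2], B as [B1 B2], D as [D1 D2],
    E as [E1 E2], G as [G1 G2], K as [K1 K2].
  pose proof (H (1, 0) 0) as Q1. pose proof (H (0, 1) 0) as Q2.
  pose proof (H (1, 1) 0) as Q3. pose proof (H (1, -1) 0) as Q4.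
  pose proof (H (1, 0) 1) as R1. pose proof (H (0, 1) 1) as R2.
  pose proof (H (1, 1) 1) as R3. pose proof (H (1, -1) 1) as R4.
  pose proof (H (1, 0) (-1)) as S1. pose proof (H (0, 1) (-1)) as S2.
  pose proof (H (1, 1) (-1)) as S3. pose proof (H (1, -1) (-1)) as S4.
  simpl in *. repeat split; apply C_ext; simpl; lra.
Qed.

Lemma Ci_square : (Ci * Ci)%C = (- (1))%C.
Proof. apply C_ext; simpl; ring. Qed.

Lemma Cconj_Ci : Cconj Ci = (- Ci)%C.
Proof. apply C_ext; simpl; ring. Qed.

Definition sphere_w (z : C) (u : R) : C := (u + Ci * (z * Cconj z))%C.

Section Weights.

Variables (f g : nat -> nat -> C) (c : C).

Notation f' j k := (f j%nat k%nat) (only parsing).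
Notation g' j k := (g j%nat k%nat) (only parsing).

(** A relation b - conj b = 2 i S says Im b = Re S. It is used with T the
polynomial in (z, zbar, u) obtained by collecting the monomials of
Re (- i b - S), each one or its conjugate; the second hypothesis is then a
polynomial identity. *)
Lemma real_part_vanishes (T b S : C) :
  (b - Cconj b = 2 * Ci * S)%C ->
  (T + Cconj T = - Ci * (b - Cconj b) - 2 * S)%C -> Re T = 0.
Proof.
  intros H E. rewrite H in E.
  replace (- Ci * (2 * Ci * S) - 2 * S)%C with (RtoC 0) in E
    by ring [Ci_square].
  apply (f_equal Re) in E. destruct T; simpl in *. lra.
Qed.

Ltac expand :=
  unfold part2, part3, part4, part5, sphere_w, quintic, Cminus;
  repeat rewrite ?Cplus_conj, ?Cmult_conj, ?Copp_conj, ?Cconj_conj, ?Cconj_R,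
    ?Cconj_Ci;
  ring [Ci_square].

Lemma im_equation (b S : C) : (b - Cconj b = 2 * Ci * S)%C -> Im b = Re S.
Proof.
  intros H. apply (f_equal Im) in H. revert H. destruct b, S; simpl. lra.
Qed.

Lemma weight_1_relation :
  (forall z, g' 1 0 * z = Cconj (g' 1 0 * z))%C -> g' 1 0 = RtoC 0.
Proof.
  intros H. pose proof (f_equal Im (H (RtoC 1))) as H1.
  pose proof (f_equal Im (H Ci)) as H2.
  destruct (g' 1 0); simpl in *. apply C_ext; simpl; lra.
Qed.

Lemma weight_2_relation :
  (forall z u, let b := part2 g z (sphere_w z u) in
     b - Cconj b = 2 * Ci * (f' 1 0 * z * Cconj (f' 1 0 * z)))%C ->
  g' 0 1 = (f' 1 0 * Cconj (f' 1 0))%C.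
Proof.
  intros H.
  pose proof (im_equation _ _ (H (RtoC 0) 1)) as H0.
  pose proof (im_equation _ _ (H (RtoC 1) 0)) as H1.
  pose proof (im_equation _ _ (H Ci 0)) as H2.
  revert H0 H1 H2. unfold part2, sphere_w.
  destruct (f' 1 0), (g' 0 1), (g' 2 0); simpl. intros H0 H1 H2.
  apply C_ext; simpl; lra.
Qed.

(** The coefficients of z u and z^2 zbar give two expressions of g_11, which are
equated; the next lemmas proceed in the same way. *)
Lemma weight_3_relation :
  (forall z u, let b := part3 g z (sphere_w z u) in
     let a1 := f' 1 0 * z in let a2 := part2 f z (sphere_w z u) in
     b - Cconj b = 2 * Ci * (a1 * Cconj a2 + a2 * Cconj a1))%C ->
  (Cconj (f' 1 0) * f' 2 0 = 2 * Ci * (f' 1 0 * Cconj (f' 0 1)))%C.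
Proof.
  intros H.
  destruct (harmonics_3
    (- Ci * g' 1 1 - 2 * (f' 1 0 * Cconj (f' 0 1)))%C
    (g' 1 1 - 2 * (Cconj (f' 1 0) * f' 2 0)
     + 2 * Ci * (f' 1 0 * Cconj (f' 0 1)))%C
    (- Ci * g' 3 0)%C) as [HA HB].
  { intros z u. apply (real_part_vanishes _ _ _ (H z u)). expand. }
  revert HA HB. set (q := (f' 1 0 * Cconj (f' 0 1))%C).
  set (v := (Cconj (f' 1 0) * f' 2 0)%C). intros HA HB.
  pose proof (f_equal Re HA) as A1. pose proof (f_equal Im HA) as A2.
  pose proof (f_equal Re HB) as B1. pose proof (f_equal Im HB) as B2.
  revert A1 A2 B1 B2. clearbody q v. destruct (g' 1 1), q, v; simpl.
  intros. apply C_ext; simpl; lra.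
Qed.

(** From z^2 u and z^3 zbar, after elimination of g_21; from u z zbar; and from
u^2 and z^2 zbar^2, after elimination of Im g_02. *)
Lemma weight_4_relations :
  (forall z u, let w := sphere_w z u in let b := part4 g z w in
     let a1 := f' 1 0 * z in let a2 := part2 f z w in let a3 := part3 f z w in
     b - Cconj b = 2 * Ci * (a1 * Cconj a3 + a2 * Cconj a2 + a3 * Cconj a1))%C ->
  (Cconj (f' 1 0) * f' 3 0 = 2 * Ci * (Cconj (f' 0 1) * f' 2 0))%C /\
  Re (g' 0 2) = Re (Cconj (f' 1 0) * f' 1 1)%C /\
  2 * Im (Cconj (f' 1 0) * f' 1 1)%C
  = Re (f' 2 0 * Cconj (f' 2 0))%C + 2 * Re (f' 0 1 * Cconj (f' 0 1))%C.
Proof.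
  intros H.
  destruct (harmonics_4
    (- Ci * g' 2 1 - 2 * (Cconj (f' 0 1) * f' 2 0))%C
    (g' 2 1 + 2 * Ci * (Cconj (f' 0 1) * f' 2 0)
     - 2 * (Cconj (f' 1 0) * f' 3 0))%C
    (- Ci * g' 4 0)%C
    (- Ci * g' 0 2 - f' 0 1 * Cconj (f' 0 1))%C
    (2 * g' 0 2 - 2 * (Cconj (f' 1 0) * f' 1 1))%C
    (Ci * g' 0 2 - f' 2 0 * Cconj (f' 2 0) - f' 0 1 * Cconj (f' 0 1)
     - 2 * Ci * (Cconj (f' 1 0) * f' 1 1))%C) as (HA & HB & Ha & Hb & Hd).
  { intros z u. apply (real_part_vanishes _ _ _ (H z u)). expand. }
  split.
  2: { revert Ha Hb Hd. set (q1 := (f' 0 1 * Cconj (f' 0 1))%C).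
       set (q2 := (f' 2 0 * Cconj (f' 2 0))%C).
       set (q3 := (Cconj (f' 1 0) * f' 1 1)%C). clearbody q1 q2 q3.
       destruct (g' 0 2), q1, q2, q3; simpl. intros. split; lra. }
  revert HA HB. set (q := (Cconj (f' 0 1) * f' 2 0)%C).
  set (v := (Cconj (f' 1 0) * f' 3 0)%C). intros HA HB.
  pose proof (f_equal Re HA) as A1. pose proof (f_equal Im HA) as A2.
  pose proof (f_equal Re HB) as B1. pose proof (f_equal Im HB) as B2.
  revert A1 A2 B1 B2. clearbody q v. destruct (g' 2 1), q, v; simpl.
  intros. apply C_ext; simpl; lra.
Qed.

(** From z u^2, z^2 zbar u and z^3 zbar^2, after elimination of g_12 and f_21. It
is in the last of these monomials that c appears, multiplied by Re g_01. *)
Lemma weight_5_relation :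
  (forall z u, let w := sphere_w z u in
     let b := part5 g z w (Ci * quintic c (Cconj c) z) in
     let a1 := f' 1 0 * z in let a2 := part2 f z w in let a3 := part3 f z w in
     let a4 := part4 f z w in
     b - Cconj b = 2 * Ci * (a1 * Cconj a4 + a2 * Cconj a3 + a3 * Cconj a2
                             + a4 * Cconj a1))%C ->
  (Re (g' 0 1) * c = - 4 * (f' 1 0 * Cconj (f' 0 2)) + Cconj (f' 2 0) * f' 3 0
                     - 2 * Ci * (f' 2 0 * Cconj (f' 1 1)))%C.
Proof.
  intros H.
  destruct (harmonics_5
    (- Ci * g' 1 2 - 2 * (f' 1 0 * Cconj (f' 0 2) + Cconj (f' 0 1) * f' 1 1))%C
    (2 * g' 1 2 - 2 * (Cconj (f' 1 0) * f' 2 1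
       - 2 * Ci * (f' 1 0 * Cconj (f' 0 2)) + f' 2 0 * Cconj (f' 1 1)))%C
    (Ci * g' 1 2 + (g' 0 1 + Cconj (g' 0 1)) * c
       - 2 * (Ci * (Cconj (f' 1 0) * f' 2 1) - f' 1 0 * Cconj (f' 0 2)
         + Cconj (f' 2 0) * f' 3 0 - Ci * (f' 2 0 * Cconj (f' 1 1))
         + Cconj (f' 0 1) * f' 1 1))%C
    (- Ci * g' 3 1 - 2 * (Cconj (f' 0 1) * f' 3 0))%C
    (g' 3 1 - 2 * (Cconj (f' 1 0) * f' 4 0 - Ci * (Cconj (f' 0 1) * f' 3 0)))%C
    (- Ci * g' 5 0)%C) as (HA & HB & HD).
  { intros z u. apply (real_part_vanishes _ _ _ (H z u)). expand. }
  replace ((g' 0 1 + Cconj (g' 0 1)) * c)%C with (2 * (Re (g' 0 1) * c))%C in HD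
    by (apply C_ext; simpl; unfold Re, Im; ring).
  revert HA HB HD.
  set (q1 := (f' 1 0 * Cconj (f' 0 2))%C). set (q2 := (Cconj (f' 0 1) * f' 1 1)%C).
  set (q3 := (Cconj (f' 1 0) * f' 2 1)%C). set (q4 := (f' 2 0 * Cconj (f' 1 1))%C).
  set (q5 := (Cconj (f' 2 0) * f' 3 0)%C). set (q6 := (Re (g' 0 1) * c)%C).
  intros HA HB HD.
  pose proof (f_equal Re HA) as A1. pose proof (f_equal Im HA) as A2.
  pose proof (f_equal Re HB) as B1. pose proof (f_equal Im HB) as B2.
  pose proof (f_equal Re HD) as D1. pose proof (f_equal Im HD) as D2.
  revert A1 A2 B1 B2 D1 D2. clearbody q1 q2 q3 q4 q5 q6.
  destruct (g' 1 2), q1, q2, q3, q4, q5, q6; simpl.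
  intros. apply C_ext; simpl; lra.
Qed.

End Weights.

Lemma Cmult_cancel (p x y : C) : p <> RtoC 0 -> (p * x = p * y)%C -> x = y.
Proof.
  intros Hp H. replace x with (/ p * (p * x))%C by (field; exact Hp).
  rewrite H. field; exact Hp.
Qed.

(** The hypotheses are the relations of weights 2 to 5, followed by the
expression of f_01 and f_02 through the 2-jet (z1, z2) of the image of the axis,
and by Sigma_0. With p = f_10 and Q = Re g_02 everything is a polynomial in p,
z1, Q and their conjugates:
f_20 = 2 i p^2 conj z1, f_30 = - 4 p^3 (conj z1)^2,
p conj f_11 = Q - 3 i |z1|^2 |p|^4, conj f_02 = conj z1 (Q - i |z1|^2 |p|^4).
In the relation of weight 5 the terms in Q cancel as - 4 + 4, and those in
i |z1|^2 |p|^4 as 4 + 8 - 12. *)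
Lemma obstruction_vanishes (f g : nat -> nat -> C) (c z1 z2 : C) :
  f 1%nat 0%nat <> RtoC 0 ->
  g 0%nat 1%nat = (f 1%nat 0%nat * Cconj (f 1%nat 0%nat))%C ->
  (Cconj (f 1%nat 0%nat) * f 2%nat 0%nat
   = 2 * Ci * (f 1%nat 0%nat * Cconj (f 0%nat 1%nat)))%C ->
  (Cconj (f 1%nat 0%nat) * f 3%nat 0%nat
   = 2 * Ci * (Cconj (f 0%nat 1%nat) * f 2%nat 0%nat))%C ->
  Re (g 0%nat 2%nat) = Re (Cconj (f 1%nat 0%nat) * f 1%nat 1%nat)%C ->
  2 * Im (Cconj (f 1%nat 0%nat) * f 1%nat 1%nat)%C
  = Re (f 2%nat 0%nat * Cconj (f 2%nat 0%nat))%C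
    + 2 * Re (f 0%nat 1%nat * Cconj (f 0%nat 1%nat))%C ->
  (Re (g 0%nat 1%nat) * c = - 4 * (f 1%nat 0%nat * Cconj (f 0%nat 2%nat))
     + Cconj (f 2%nat 0%nat) * f 3%nat 0%nat
     - 2 * Ci * (f 2%nat 0%nat * Cconj (f 1%nat 1%nat)))%C ->
  f 0%nat 1%nat = (z1 * Re (g 0%nat 1%nat))%C ->
  (2 * f 0%nat 2%nat = z2 * (Re (g 0%nat 1%nat) * Re (g 0%nat 1%nat))
     + 2 * (z1 * Re (g 0%nat 2%nat)))%C ->
  z2 = (2 * Ci * (z1 * z1 * Cconj z1))%C ->
  c = RtoC 0.
Proof.
  set (p := f 1%nat 0%nat). set (b := f 0%nat 1%nat).
  set (a20 := f 2%nat 0%nat). set (a30 := f 3%nat 0%nat).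
  set (a11 := f 1%nat 1%nat). set (a02 := f 0%nat 2%nat).
  intros Hp Hg Ha20 Ha30 Hg02 Hima11 Hc Hb Ha02 Hz2.
  set (Q := Re (g 0%nat 2%nat)) in *.
  set (P := Re (g 0%nat 1%nat)) in *.
  assert (HP : RtoC P = (p * Cconj p)%C).
  { unfold P. rewrite Hg. apply C_ext; simpl; unfold Re, Im; ring. }
  assert (Hpb : Cconj p <> RtoC 0).
  { intros H. apply Hp. rewrite <- (Cconj_conj p), H. apply C_ext; simpl; ring. }
  assert (Hbb : Cconj b = (Cconj z1 * (p * Cconj p))%C).
  { rewrite Hb, Cmult_conj, Cconj_R, HP. reflexivity. }
  assert (E20 : a20 = (2 * Ci * (p * p * Cconj z1))%C).
  { apply (Cmult_cancel (Cconj p)); [exact Hpb|]. rewrite Ha20, Hbb. ring. }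
  assert (E20b : Cconj a20 = (- 2 * Ci * (Cconj p * Cconj p * z1))%C).
  { rewrite E20, !Cmult_conj, Cconj_Ci, Cconj_R, Cconj_conj. ring. }
  assert (E30 : a30 = (- 4 * (p * p * p * Cconj z1 * Cconj z1))%C).
  { apply (Cmult_cancel (Cconj p)); [exact Hpb|]. rewrite Ha30, Hbb, E20.
    ring [Ci_square]. }
  assert (E11 : (p * Cconj a11
    = Q - 3 * Ci * (z1 * Cconj z1 * (p * Cconj p) * (p * Cconj p)))%C).
  { assert (Hn : RtoC (2 * Im (Cconj p * a11)%C)
      = (6 * (z1 * Cconj z1 * (p * Cconj p) * (p * Cconj p)))%C).
    { rewrite Hima11, RtoC_plus, RtoC_mult.
      assert (Hre : forall x, RtoC (Re (x * Cconj x)%C) = (x * Cconj x)%C)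
        by (intros; apply C_ext; simpl; unfold Re, Im; ring).
      rewrite !Hre, E20b, E20, Hbb, Hb, HP. ring [Ci_square]. }
    transitivity (Q - Ci * RtoC (Im (Cconj p * a11)%C))%C.
    - rewrite Hg02. apply C_ext; simpl; unfold Re, Im; ring.
    - rewrite RtoC_mult in Hn.
      apply (Cmult_cancel 2); [intros H; apply RtoC_inj in H; lra|].
      transitivity (2 * Q - Ci * (2 * RtoC (Im (Cconj p * a11))))%C; [ring|].
      rewrite Hn. ring. }
  assert (E02b : Cconj a02
    = (Cconj z1 * Q
       - Ci * (Cconj z1 * Cconj z1 * z1 * (p * Cconj p) * (p * Cconj p)))%C).
  { apply (Cmult_cancel 2); [intros H; apply RtoC_inj in H; lra|].
    transitivity (Cconj (2 * a02)).
    { now rewrite Cmult_conj, Cconj_R. }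
    rewrite Ha02, Hz2, HP.
    rewrite !Cplus_conj, !Cmult_conj, !Cconj_conj, Cconj_Ci, !Cconj_R. ring. }
  apply (Cmult_cancel (p * Cconj p)).
  { intros H. apply Hp. apply (Cmult_cancel (Cconj p)); [exact Hpb|].
    rewrite Cmult_comm, H. ring. }
  rewrite <- HP, Hc, E02b, E20b, E30.
  transitivity (- 4 * (p * (Cconj z1 * Q - Ci * (Cconj z1 * Cconj z1 * z1
      * (p * Cconj p) * (p * Cconj p))))
    + - 2 * Ci * (Cconj p * Cconj p * z1)
      * (- 4 * (p * p * p * Cconj z1 * Cconj z1))
    - 2 * Ci * (2 * Ci * (p * Cconj z1)) * (p * Cconj a11))%C.
  { rewrite E20. ring. }
  rewrite E11. ring [Ci_square].
Qed.

(** * The 2-jet of the image of the axis *)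

Lemma jet_re (X : R -> C) (c0 c1 c2 c3 c4 c5 : C) :
  jet X c0 c1 c2 c3 c4 c5 ->
  jet (fun s : R => RtoC (Re (X s))) (Re c0) (Re c1) (Re c2) (Re c3) (Re c4)
    (Re c5).
Proof.
  intros (h & [K HK] & E). exists (fun s : R => RtoC (Re (h s))). split.
  - exists K. revert HK. apply filter_imp. intros s H.
    rewrite Cmod_R. eapply Rle_trans; [apply re_le_Cmod|exact H].
  - revert E. apply filter_imp. intros s ->.
    apply C_ext; simpl; unfold Re, Im; ring.
Qed.

(** After three steps of Horner division the remainder is t^3 times a power
series, which is bounded near 0. *)
Lemma real_analytic_taylor (x : R -> R) :
  real_analytic_at x 0 ->
  exists K, locally 0 (fun t =>
    Rabs (x t - (x 0 + t * (Derive x 0 + t * (Derive_n x 2 0 / 2))))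
    <= K * Rabs t ^ 3).
Proof.
  intros (a & Ha & Hx).
  assert (Hx' : locally 0 (fun t => x t = PSeries a t)).
  { revert Hx. apply filter_imp. intros t ->. now rewrite Rminus_0_r. }
  assert (E0 : x 0 = a 0%nat).
  { rewrite (locally_singleton _ _ Hx'). apply PSeries_0. }
  assert (E1 : Derive x 0 = a 1%nat).
  { pose proof (Derive_n_coef a 1 Ha) as H1. simpl in H1.
    rewrite (Derive_ext_loc _ _ _ Hx'), <- (Rmult_1_r (a 1%nat)). exact H1. }
  assert (E2 : Derive_n x 2 0 / 2 = a 2%nat).
  { rewrite (Derive_n_ext_loc _ _ 2 _ Hx'), (Derive_n_coef a 2 Ha). simpl. field. }
  set (b := PS_decr_1 (PS_decr_1 (PS_decr_1 a))).
  assert (Hb : continuity_pt (PSeries b) 0).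
  { apply PSeries_continuity. unfold b. rewrite !CV_radius_decr_1, Rabs_R0.
    exact Ha. }
  apply continuity_pt_filterlim in Hb.
  assert (Hbb : locally 0 (fun t => Rabs (PSeries b t) <= Rabs (PSeries b 0) + 1)).
  { pose proof (proj1 (filterlim_locally _ _) Hb (mkposreal 1 Rlt_0_1)) as H.
    revert H. apply filter_imp. intros t Ht.
    assert (Ht' : Rabs (PSeries b t - PSeries b 0) < 1) by exact Ht.
    pose proof (Rabs_triang (PSeries b t - PSeries b 0) (PSeries b 0)) as H1.
    replace (PSeries b t - PSeries b 0 + PSeries b 0) with (PSeries b t) in H1
      by ring. lra. }
  assert (Hconv : locally 0 (fun t => ex_pseries a t)).
  { assert (Hr : exists r, 0 < r /\ Rbar_le r (CV_radius a)).
    { destruct (CV_radius a) as [r| |].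
      - exists r. split; [exact Ha|apply Rle_refl].
      - exists 1. split; [lra|exact I].
      - destruct Ha. }
    destruct Hr as (r & Hr & Hra).
    exists (mkposreal r Hr). intros t Ht.
    apply CV_disk_correct, CV_disk_inside.
    apply (CV_radius_gt r); [exact Hra|].
    rewrite <- (Rminus_0_r t). exact Ht. }
  exists (Rabs (PSeries b 0) + 1).
  generalize (filter_and _ _ (filter_and _ _ Hx' Hbb) Hconv).
  apply filter_imp. intros t [[H1 H2] H3].
  assert (Hdecr : forall a' : nat -> R, ex_pseries a' t ->
             ex_pseries (PS_decr_1 a') t).
  { intros a' H. apply ex_pseries_decr_1; [|exact H].
    destruct (Req_dec t 0) as [|Ht]; [now left|right].
    exists (/ t). change (/ t * t = 1). now field. }
  rewrite E0, E1, E2, H1, (PSeries_decr_1 a t), (PSeries_decr_1 (PS_decr_1 a) t),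
    (PSeries_decr_1 (PS_decr_1 (PS_decr_1 a)) t) by auto.
  fold b.
  match goal with |- Rabs ?e <= _ => replace e with (PSeries b t * t ^ 3)
    by (unfold PS_decr_1; ring) end.
  rewrite Rabs_mult, RPow_abs. apply Rmult_le_compat_r; [apply Rabs_pos|exact H2].
Qed.

Lemma at_right_tends_to_0 (X : R -> C) (c1 c2 c3 c4 c5 : C) (e : R) :
  0 < e -> jet X 0 c1 c2 c3 c4 c5 -> at_right 0 (fun s : R => Cmod (X s) < e).
Proof.
  intros He HX. destruct (jet_bound_1 _ _ _ _ _ _ HX) as [K [HK0 HK]].
  assert (Hd : 0 < e / K) by now apply Rdiv_lt_0_compat.
  generalize (filter_and _ _ HK (at_right_small _ Hd)). apply filter_imp.
  intros s [H1 [H2 H3]]. apply Rlt_div_r in H3; [|exact HK0]. lra.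
Qed.

Lemma jet_comp_analytic (x : R -> R) (tau : R -> R) (P Q : R) :
  real_analytic_at x 0 ->
  jet (fun s : R => RtoC (tau s)) 0 0 P 0 Q 0 ->
  jet (fun s : R => RtoC (x (tau s))) (x 0) 0 (Derive x 0 * P)%C 0
    (Derive x 0 * Q + Derive_n x 2 0 / 2 * (P * P))%C 0.
Proof.
  intros Hx Ht. destruct (real_analytic_taylor x Hx) as [K [e He]].
  destruct (jet_bound_2 _ _ _ _ _ Ht) as [W [HW0 HW]].
  set (q := Derive_n x 2 0 / 2) in *.
  assert (Eq : RtoC (Derive_n x 2 0) = (2 * q)%C).
  { unfold q. rewrite RtoC_div by lra. field. }
  pose proof (jet_plus _ _ _ _ _ _ _ _ _ _ _ _ _ _ (jet_const (x 0))
    (jet_mult _ _ _ _ _ _ _ _ _ _ _ _ _ _ Ht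
      (jet_plus _ _ _ _ _ _ _ _ _ _ _ _ _ _ (jet_const (Derive x 0))
         (jet_mult _ _ _ _ _ _ _ _ _ _ _ _ _ _ Ht (jet_const q))))) as HY.
  refine (jet_coefficients _ _ _ _ _ _ _ _ _ _ _ _ _
    (jet_of_bound _ _ _ _ _ _ _ _ (Rabs K * W ^ 3) HY _) _ _ _ _ _ _);
    try (rewrite ?Eq; field).
  generalize (filter_and _ _ HW (filter_and _ _ at_right_pos
    (at_right_tends_to_0 _ _ _ _ _ _ e (cond_pos e) Ht))).
  apply filter_imp. intros s [H1 [H0 H2]].
  rewrite Cmod_R in H1, H2.
  assert (Hb : ball 0 e (tau s)).
  { change (Rabs (tau s - 0) < e). now rewrite Rminus_0_r. }
  specialize (He _ Hb).
  rewrite <- !RtoC_mult, <- !RtoC_plus, <- RtoC_mult, <- RtoC_plus,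
    <- RtoC_minus, Cmod_R.
  eapply Rle_trans; [exact He|].
  replace (Rabs K * W ^ 3 * s ^ 6) with (Rabs K * (W * s ^ 2) ^ 3) by ring.
  pose proof (Rabs_pos (tau s)) as Hp.
  apply Rle_trans with (Rabs K * Rabs (tau s) ^ 3).
  - apply Rmult_le_compat_r; [now apply pow_le|apply Rle_abs].
  - apply Rmult_le_compat_l; [apply Rabs_pos|now apply pow_incr].
Qed.

(** F along the weighted curve through (0, u0): the expansion of F in powers of
(z, zbar), with its coefficient functions frozen at u0. *)
Lemma normal_path_jet (F : C -> R -> R) (a : nat -> nat -> nat -> C) (r B u0 : R)
  (zeta : C) (u : R) :
  0 < r -> abs_summable3 a r -> Rabs u0 < r ->
  (forall z u t, 0 <= t < 1 -> Cmod z <= r * t -> Rabs u < r ->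
    Cmod (RtoC (F z u)
      - (z * Cconj z + quintic (coef a 3 2 u) (coef a 2 3 u) z)) <= t ^ 6 * B) ->
  jet (fun s : R => RtoC (F (s * zeta)%C (u0 + s ^ 2 * u))) 0 0
    (zeta * Cconj zeta) 0 0
    (quintic (coef a 3 2 u0) (coef a 2 3 u0) zeta).
Proof.
  intros Hr Ha Hu0 HF.
  set (m := (zeta * zeta * zeta * Cconj zeta * Cconj zeta)%C).
  set (m' := (zeta * zeta * Cconj zeta * Cconj zeta * Cconj zeta)%C).
  destruct (scaling_factor (Cmod zeta) 0 r Hr (Cmod_ge_0 _)) as (k & Hk & Hz & _);
    [lra|].
  set (v := fun s : R => s ^ 2 * u).
  assert (Hv : forall e, 0 < e -> at_right 0 (fun s : R => Rabs (v s) < e)).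
  { intros e He.
    assert (Hj : jet (fun s : R => RtoC (v s)) 0 0 u 0 0 0).
    { exists (fun _ => RtoC 0); split; [bounded|].
      apply filter_forall; intros s. unfold v.
      rewrite RtoC_mult, RtoC_pow. ring. }
    generalize (at_right_tends_to_0 _ _ _ _ _ _ e He Hj). apply filter_imp.
    intros s. now rewrite Cmod_R. }
  assert (Hc : forall j l, exists h, bounded_near_0 h /\
    at_right 0 (fun s : R => coef a j l (u0 + v s) = coef a j l u0 + s * h s)%C).
  { intros j l.
    destruct (coef_lipschitz a r Hr Ha j l u0 Hu0) as [K [e He]].
    exists (fun s : R => (coef a j l (u0 + v s) - coef a j l u0) / s)%C. split.
    - exists (Rabs K * Rabs u).
      generalize (filter_and _ _ (Hv e (cond_pos e)) (at_right_small 1 Rlt_0_1)).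
      apply filter_imp. intros s [H1 H2].
      assert (Hb : ball 0 e (v s)).
      { change (Rabs (v s - 0) < e). now rewrite Rminus_0_r. }
      specialize (He _ Hb).
      rewrite Cmod_div, Cmod_R, (Rabs_pos_eq s) by (try apply RtoC_neq_0; lra).
      apply Rle_div_l; [lra|]. eapply Rle_trans; [exact He|].
      unfold v. rewrite Rabs_mult, (Rabs_pos_eq (s ^ 2)) by (apply pow_le; lra).
      pose proof (Rle_abs K). pose proof (Rabs_pos u). pose proof (Rabs_pos K).
      assert (s ^ 2 <= s) by (simpl; nra).
      apply Rle_trans with (Rabs K * (s ^ 2 * Rabs u)).
      + apply Rmult_le_compat_r; [|assumption]. apply Rmult_le_pos; [|lra].
        apply pow_le; lra.
      + rewrite Rmult_assoc. apply Rmult_le_compat_l; [lra|]. nra.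
    - generalize at_right_pos. apply filter_imp. intros s Hs. field.
      now apply RtoC_neq_0. }
  destruct (Hc 3%nat 2%nat) as (h1 & B1 & E1).
  destruct (Hc 2%nat 3%nat) as (h2 & B2 & E2).
  apply (jet_of_bound _ (fun s : R => let z := (s * zeta)%C in
      z * Cconj z
      + quintic (coef a 3 2 (u0 + v s)) (coef a 2 3 (u0 + v s)) z)%C
      _ _ _ _ _ _ (k ^ 6 * B)).
  - exists (fun s : R => h1 s * m + h2 s * m')%C. split; [bounded|].
    generalize (filter_and _ _ E1 E2). apply filter_imp.
    intros s [H1 H2]. unfold quintic. rewrite H1, H2, !Cmult_conj, !Cconj_R.
    unfold m, m'. ring.
  - assert (Hd : 0 < / k) by (apply Rinv_0_lt_compat; lra).
    assert (He : 0 < r - Rabs u0) by lra.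
    generalize (filter_and _ _ (Hv _ He) (at_right_small _ Hd)). apply filter_imp.
    intros s [H1 [H2 H3]].
    assert (Hks : k * s < 1).
    { apply (Rmult_lt_compat_l k) in H3; [|lra].
      rewrite Rinv_r in H3; lra. }
    replace (k ^ 6 * B * s ^ 6) with ((k * s) ^ 6 * B) by ring.
    apply HF.
    + split; [nra|exact Hks].
    + rewrite Cmod_mult, Cmod_R, Rabs_pos_eq by lra.
      replace (r * (k * s)) with (s * (r * k)) by ring.
      apply Rmult_le_compat_l; lra.
    + eapply Rle_lt_trans; [apply Rabs_triang|]. lra.
Qed.

(** The values z = 1 and z = i show that c + c' and i (c - c') are real. *)
Lemma real_quintic_conj (c c' : C) :
  (forall z, quintic c c' z = Cconj (quintic c c' z)) -> c' = Cconj c.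
Proof.
  intros H. pose proof (f_equal Im (H (RtoC 1))) as H1.
  pose proof (f_equal Im (H Ci)) as H2.
  destruct c, c'; simpl in *. apply C_ext; simpl; lra.
Qed.

Lemma locally_Cmod (P : C * C -> Prop) (p0 : C * C) :
  locally p0 P ->
  exists e, 0 < e /\ forall z w, Cmod (z - fst p0) < e -> Cmod (w - snd p0) < e ->
    P (z, w).
Proof.
  intros [e He]. exists e; split; [apply cond_pos|]. intros z w Hz Hw.
  apply He. split; now apply C_NormedModule_mixin_compat1.
Qed.

(** Along u = s^2 the first coordinate of the image curve is
f_01 s^2 + f_02 s^4 + ..., and the real part of the second is
P s^2 + Q s^4 + ... with P = Re g_01, Q = Re g_02. The curve being the graph of
x + i y over this real part, composition of Taylor expansions gives
f_01 = z1 P and f_02 = z1 Q + z2 P^2 / 2. Moreover P is the derivative of the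
parameter of the graph, hence is not 0. *)
Lemma axis_jet (Phi : C * C -> C * C) (f g : nat -> nat -> C) (u0 : R)
  (x1 y1 x2 y2 : R) :
  Phi origin = origin ->
  jet (fun s : R => fst (Phi (s * 0, RtoC (s ^ 2))%C)) 0 0 (f 0%nat 1%nat) 0
    (f 0%nat 2%nat) 0 ->
  jet (fun s : R => snd (Phi (s * 0, RtoC (s ^ 2))%C)) 0 0 (g 0%nat 1%nat) 0
    (g 0%nat 2%nat) 0 ->
  graph_jet2 (fun s => Phi (tau (u_axis u0) (u_axis s))) u0 x1 y1 x2 y2 ->
  let z1 := (x1, y1) : C in let z2 := (x2, y2) : C in
  RtoC (Re (g 0%nat 1%nat)) <> RtoC 0 /\
  f 0%nat 1%nat = (z1 * Re (g 0%nat 1%nat))%C /\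
  (2 * f 0%nat 2%nat = z2 * (Re (g 0%nat 1%nat) * Re (g 0%nat 1%nat))
     + 2 * (z1 * Re (g 0%nat 2%nat)))%C.
Proof.
  intros HPhi Hf Hg (x & y & H). cbv zeta in H.
  set (U := fun s => Re (snd (Phi (tau (u_axis u0) (u_axis s))))) in H.
  destruct H as (HU & HU0 & Hx & Hy & Hloc & -> & -> & -> & ->).
  assert (Hpath : forall s, tau (u_axis u0) (u_axis (u0 + s ^ 2))
                            = (s * 0, RtoC (s ^ 2))%C).
  { intros s. unfold tau, u_axis; simpl.
    apply f_equal2; apply C_ext; simpl; ring. }
  assert (EU : U u0 = 0).
  { unfold U. replace (tau (u_axis u0) (u_axis u0)) with origin
      by (unfold tau, u_axis, origin; simpl;
          apply f_equal2; apply C_ext; simpl; ring).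
    now rewrite HPhi. }
  rewrite EU in Hx, Hy.
  set (P := Re (g 0%nat 1%nat)). set (Q := Re (g 0%nat 2%nat)).
  assert (Htau : jet (fun s : R => RtoC (U (u0 + s ^ 2))) 0 0 P 0 Q 0).
  { apply (jet_ext (fun s : R => RtoC (Re (snd (Phi (s * 0, RtoC (s ^ 2))%C))))).
    - apply filter_forall; intros s. unfold U. now rewrite Hpath.
    - exact (jet_re _ _ _ _ _ _ _ Hg). }
  assert (Hsq : forall e, 0 < e -> at_right 0 (fun s : R => Rabs (s ^ 2) < e)).
  { intros e He.
    assert (Hj : jet (fun s : R => RtoC (s ^ 2)) 0 0 1 0 0 0).
    { exists (fun _ => RtoC 0); split; [bounded|].
      apply filter_forall; intros s. rewrite RtoC_pow. ring. }
    generalize (at_right_tends_to_0 _ _ _ _ _ _ e He Hj). apply filter_imp.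
    intros s. now rewrite Cmod_R. }
  assert (Hpull : forall A : R -> Prop, locally u0 A ->
            at_right 0 (fun s : R => A (u0 + s ^ 2))).
  { intros A [e He]. generalize (Hsq e (cond_pos e)). apply filter_imp.
    intros s Hs. apply He.
    change (Rabs (u0 + s ^ 2 - u0) < e).
    now replace (u0 + s ^ 2 - u0) with (s ^ 2) by ring. }
  (* If P were 0, the parameter U would be O(s^3) at the points u0 + s^2,
     against its nonzero derivative d. *)
  split.
  - intros HP0. rewrite HP0 in Htau.
    assert (Hq : exists K, 0 < K /\
              at_right 0 (fun s : R => Rabs (U (u0 + s ^ 2)) <= K * s ^ 2 * s)).
    { destruct Htau as (h & Hh & E).
      destruct (bounded_pos (fun s : R => Q + s * (0 + s * h s))%C) as [K [HK0 HK]];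
        [bounded|].
      exists K; split; [exact HK0|].
      generalize (filter_and _ _ (filter_and _ _ E HK) (at_right_small 1 Rlt_0_1)).
      apply filter_imp. intros s [[H1 H2] H3].
      rewrite <- Cmod_R, H1.
      match goal with |- Cmod ?e <= _ =>
        replace e with (s * s * s * s * (Q + s * (0 + s * h s)))%C by ring end.
      rewrite Cmod_mult, <- !RtoC_mult, Cmod_R, Rabs_pos_eq
        by (assert (0 < s * s) by nra; nra).
      pose proof (Cmod_ge_0 (Q + s * (0 + s * h s))).
      assert (0 < s * s * s) by (assert (0 < s * s) by nra; nra).
      replace (K * s ^ 2 * s) with (s * s * s * K) by ring.
      apply Rle_trans with (s * s * s * Cmod (Q + s * (0 + s * h s))).
      - apply Rmult_le_compat_r; [assumption|]. nra.
      - apply Rmult_le_compat_l; lra. }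
    destruct Hq as [K [HK0 HK]].
    destruct HU as [d Hd]. apply is_derive_unique in Hd as Ed.
    rewrite Ed in HU0. apply HU0.
    destruct Hd as [_ Hd].
    destruct (Req_dec d 0) as [|Hd0]; [assumption|exfalso].
    assert (Hdp : 0 < Rabs d / 2) by (pose proof (Rabs_pos_lt d Hd0); lra).
    specialize (Hd u0 (fun A HA => HA) (mkposreal _ Hdp)). simpl in Hd.
    apply Hpull in Hd.
    assert (Hsm : 0 < Rabs d / 2 / K) by now apply Rdiv_lt_0_compat.
    destruct (filter_ex _ (filter_and _ _ (filter_and _ _ HK Hd)
                             (at_right_small _ Hsm))) as [s [[H1 H2] [H3 H4]]].
    unfold norm, minus, plus, opp, scal in H2; simpl in H2;
      unfold abs, mult in H2; simpl in H2.
    rewrite EU in H2.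
    apply Rlt_div_r in H4; [|exact HK0].
    replace (u0 + s * (s * 1) + - u0) with (s ^ 2) in H2 by (simpl; ring).
    change (s * (s * 1)) with (s ^ 2) in H2.
    assert (Hs2 : 0 < s ^ 2) by (apply pow_lt; lra).
    rewrite (Rabs_pos_eq (s ^ 2)) in H2 by lra.
    assert (H5 : Rabs (s ^ 2 * d) <=
      Rabs (U (u0 + s ^ 2)) + Rabs (U (u0 + s ^ 2) + - 0 + - (s ^ 2 * d))).
    { replace (s ^ 2 * d) with (U (u0 + s ^ 2)
        + - (U (u0 + s ^ 2) + - 0 + - (s ^ 2 * d))) at 1 by ring.
      eapply Rle_trans; [apply Rabs_triang|]. rewrite Rabs_Ropp. lra. }
    rewrite Rabs_mult, (Rabs_pos_eq (s ^ 2)) in H5 by lra. nra.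
  - pose proof (jet_plus _ _ _ _ _ _ _ _ _ _ _ _ _ _
      (jet_comp_analytic x _ P Q Hx Htau)
      (jet_mult _ _ _ _ _ _ _ _ _ _ _ _ _ _ (jet_const Ci)
         (jet_comp_analytic y _ P Q Hy Htau))) as HJ.
    apply (jet_ext _ (fun s : R => fst (Phi (s * 0, RtoC (s ^ 2))%C))) in HJ.
    2: { apply Hpull in Hloc. revert Hloc. apply filter_imp. intros s Hs.
         rewrite Hpath in Hs. rewrite Hs.
         apply C_ext; simpl; unfold U; simpl; ring. }
    destruct (jet_unique _ _ _ _ _ _ _ _ _ _ _ _ _ Hf HJ)
      as (_ & _ & E2 & _ & E4 & _).
    rewrite EU, E2, E4.
    assert (Hpair : forall p q : R, ((p, q) : C) = (p + Ci * q)%C)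
      by (intros; apply C_ext; simpl; ring).
    rewrite !Hpair. split; [ring|field].
Qed.

(** ** A point of the axis *)

Section Local.

Variables (M : C * C -> Prop) (F : C -> R -> R).
Variables (a : nat -> nat -> nat -> C) (r B d u0 : R).
Hypotheses (r_pos : 0 < r) (summable : abs_summable3 a r) (Hu0 : Rabs u0 < r)
  (F_expansion : forall z u t, 0 <= t < 1 -> Cmod z <= r * t -> Rabs u < r ->
    Cmod (RtoC (F z u)
      - (z * Cconj z + quintic (coef a 3 2 u) (coef a 2 3 u) z)) <= t ^ 6 * B)
  (M_graph : forall z w, Cmod z < d -> Cmod w < d -> M (z, w) <-> graph F (z, w))
  (Hud : Rabs u0 < d)
  (Hjet : jet_in_Sigma M u_axis u0).

(** F is real, so the part of weight 5 of its expansion is invariant under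
conjugation. *)
Lemma coef_conj : coef a 2 3 u0 = Cconj (coef a 3 2 u0).
Proof.
  apply real_quintic_conj. intros z.
  pose proof (normal_path_jet F a r B u0 z 0 r_pos summable Hu0 F_expansion) as H.
  pose proof (jet_ext _ (fun s : R => RtoC (F (s * z)%C (u0 + s ^ 2 * 0)))
    _ _ _ _ _ _ ltac:(apply filter_forall; intros; apply Cconj_R)
    (jet_conj _ _ _ _ _ _ _ H)) as H'.
  exact (proj2 (proj2 (proj2 (proj2 (proj2
    (jet_unique _ _ _ _ _ _ _ _ _ _ _ _ _ H H')))))).
Qed.

(** The relations between Taylor coefficients are obtained by moving along
M, translated to u0, on the curves s |-> (s z, W z u s); those along the axis by
taking z = 0. Nonvanishing of f_10 follows from P = |f_10|^2. *)
Lemma coef_32_vanishes : coef a 3 2 u0 = RtoC 0.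
Proof.
  destruct Hjet as (phi & (Phi & N & (H0 & Hf & Hg & _) & (E & HE & HN) & HMN & Hphi)
                    & x1 & y1 & x2 & y2 & HG & HS).
  destruct (holomorphic_expansion _ Hf) as (f & rf & Bf & Hrf & Hfexp).
  destruct (holomorphic_expansion _ Hg) as (g & rg & Bg & Hrg & Hgexp).
  assert (const_0 : forall (k : C * C -> C) (c : nat -> nat -> C) rk Bk,
    k origin = RtoC 0 ->
    (forall z w t, 0 <= t < 1 -> Cmod z <= rk * t -> Cmod w <= rk * t ^ 2 ->
      Cmod (k (z, w) - weighted_poly c z w) <= t ^ 6 * Bk) ->
    c 0%nat 0%nat = RtoC 0).
  { intros k c rk Bk Hk Hexp.
    specialize (Hexp 0 0 0 ltac:(lra) ltac:(rewrite Cmod_0; lra)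
                  ltac:(rewrite Cmod_0; simpl; lra)).
    change (k (RtoC 0, RtoC 0)) with (k origin) in Hexp. rewrite Hk in Hexp.
    replace (weighted_poly c 0 0) with (c 0%nat 0%nat) in Hexp
      by (unfold weighted_poly; ring).
    replace (0 ^ 6 * Bk) with 0 in Hexp by ring.
    replace (0 - c 0%nat 0%nat)%C with (- c 0%nat 0%nat)%C in Hexp by ring.
    rewrite Cmod_opp in Hexp. apply Cmod_eq_0.
    pose proof (Cmod_ge_0 (c 0%nat 0%nat)). lra. }
  assert (f00 : f 0%nat 0%nat = RtoC 0).
  { exact (const_0 (fun p => fst (Phi p)) f rf Bf (f_equal fst H0) Hfexp). }
  assert (g00 : g 0%nat 0%nat = RtoC 0).
  { exact (const_0 (fun p => snd (Phi p)) g rg Bg (f_equal snd H0) Hgexp). }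
  set (c := coef a 3 2 u0).
  set (W := fun (z : C) (u s : R) =>
    (RtoC (s ^ 2 * u) + Ci * F (s * z)%C (u0 + s ^ 2 * u))%C).
  assert (HW : forall z u, jet (W z u) 0 0 (sphere_w z u) 0 0
                             (Ci * quintic c (Cconj c) z)%C).
  { intros z u.
    assert (Hs : jet (fun s : R => RtoC (s ^ 2 * u)) 0 0 u 0 0 0).
    { exists (fun _ => RtoC 0); split; [bounded|].
      apply filter_forall; intros s. rewrite RtoC_mult, RtoC_pow. ring. }
    pose proof (jet_plus _ _ _ _ _ _ _ _ _ _ _ _ _ _ Hs
      (jet_mult _ _ _ _ _ _ _ _ _ _ _ _ _ _ (jet_const Ci)
         (normal_path_jet F a r B u0 z u r_pos summable Hu0 F_expansion))) as HJ.
    rewrite coef_conj in HJ. fold c in HJ.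
    unfold W, sphere_w.
    apply (jet_coefficients _ _ _ _ _ _ _ _ _ _ _ _ _ HJ); ring. }
  set (X := fun (z : C) (u s : R) => fst (Phi (s * z, W z u s)%C)).
  set (G := fun (z : C) (u s : R) => snd (Phi (s * z, W z u s)%C)).
  assert (HX : forall z u, jet (X z u) 0 (f 1%nat 0%nat * z)
    (part2 f z (sphere_w z u)) (part3 f z (sphere_w z u)) (part4 f z (sphere_w z u))
    (part5 f z (sphere_w z u) (Ci * quintic c (Cconj c) z))).
  { intros z u. rewrite <- f00.
    exact (holomorphic_jet (fun p => fst (Phi p)) f rf Bf z _ _ _
             Hrf Hfexp (HW z u)). }
  assert (HGj : forall z u, jet (G z u) 0 (g 1%nat 0%nat * z)
    (part2 g z (sphere_w z u)) (part3 g z (sphere_w z u)) (part4 g z (sphere_w z u))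
    (part5 g z (sphere_w z u) (Ci * quintic c (Cconj c) z))).
  { intros z u. rewrite <- g00.
    exact (holomorphic_jet (fun p => snd (Phi p)) g rg Bg z _ _ _
             Hrg Hgexp (HW z u)). }
  assert (Heq : forall z u, at_right 0 (fun s : R =>
    Im (G z u s) = Cmod (X z u s) ^ 2 + E (X z u s) (Re (G z u s)))).
  { intros z u.
    destruct (locally_Cmod _ _ HMN) as (e & He & HMN').
    set (e' := Rmin e (d - Rabs u0)).
    assert (He' : 0 < e') by (apply Rmin_pos; lra).
    assert (Hz : jet (fun s : R => s * z)%C 0 z 0 0 0 0).
    { exists (fun _ => RtoC 0); split; [bounded|].
      apply filter_forall; intros s. ring. }
    generalize (filter_and _ _ (at_right_tends_to_0 _ _ _ _ _ _ e' He' Hz)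
                  (at_right_tends_to_0 _ _ _ _ _ _ e' He' (HW z u))).
    apply filter_imp. intros s [H1 H2].
    assert (L1 : e' <= e) by apply Rmin_l.
    assert (L2 : e' <= d - Rabs u0) by apply Rmin_r.
    pose proof (Rabs_pos u0) as Hp.
    apply (HN (Phi (s * z, W z u s)%C)).
    apply HMN'.
    { simpl. replace (s * z - 0)%C with (s * z)%C by ring. lra. }
    { simpl. replace (W z u s - 0)%C with (W z u s) by ring. lra. }
    exists (s * z, u0 + W z u s)%C. split.
    - apply M_graph.
      + lra.
      + eapply Rle_lt_trans; [apply Cmod_triangle|]. rewrite Cmod_R. lra.
      + unfold graph, W; simpl.
        replace (u0 + (s * (s * 1) * u + _)) with (u0 + s * (s * 1) * u)
          by ring.
        ring.
    - unfold tau, u_axis; simpl. apply f_equal2; ring. }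
  assert (g10 : g 1%nat 0%nat = RtoC 0).
  { apply weight_1_relation. intros z.
    exact (weight_1 _ _ E _ _ _ _ _ _ _ _ _ _ (HGj z 0) (HX z 0) HE (Heq z 0)). }
  assert (HGj' : forall z u, jet (G z u) 0 0
    (part2 g z (sphere_w z u)) (part3 g z (sphere_w z u)) (part4 g z (sphere_w z u))
    (part5 g z (sphere_w z u) (Ci * quintic c (Cconj c) z))).
  { intros z u. pose proof (HGj z u) as H. rewrite g10, Cmult_0_l in H. exact H. }
  assert (Hw : forall z u, _) by
    exact (fun z u => weights_2_to_5 _ _ E _ _ _ _ _ _ _ _ _ (HGj' z u) (HX z u)
                        HE (Heq z u)).
  cbv beta in Hw.
  pose proof (weight_2_relation f g (fun z u => proj1 (Hw z u))) as R2.
  pose proof (weight_3_relation f g (fun z u => proj1 (proj2 (Hw z u)))) as R3.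
  destruct (weight_4_relations f g (fun z u => proj1 (proj2 (proj2 (Hw z u)))))
    as (R4 & R4' & R4'').
  pose proof (weight_5_relation f g c
                (fun z u => proj2 (proj2 (proj2 (Hw z u))))) as R5.
  assert (Haxis : forall k (kc : nat -> nat -> C) rk Bk, 0 < rk ->
    (forall z w t, 0 <= t < 1 -> Cmod z <= rk * t -> Cmod w <= rk * t ^ 2 ->
      Cmod (k (z, w) - weighted_poly kc z w) <= t ^ 6 * Bk) ->
    kc 0%nat 0%nat = RtoC 0 ->
    jet (fun s : R => k (s * 0, RtoC (s ^ 2))%C) 0 0 (kc 0%nat 1%nat) 0
      (kc 0%nat 2%nat) 0).
  { intros k kc rk Bk Hrk Hexp Hk0.
    assert (Hj : jet (fun s : R => RtoC (s ^ 2)) 0 0 1 0 0 0).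
    { exists (fun _ => RtoC 0); split; [bounded|].
      apply filter_forall; intros s. rewrite RtoC_pow. ring. }
    pose proof (holomorphic_jet k kc rk Bk 0 _ _ _ Hrk Hexp Hj) as HJ.
    unfold part2, part3, part4, part5 in HJ.
    apply (jet_coefficients _ _ _ _ _ _ _ _ _ _ _ _ _ HJ);
      [exact Hk0|ring..]. }
  assert (HG' : graph_jet2 (fun s => Phi (tau (u_axis u0) (u_axis s))) u0
                  x1 y1 x2 y2).
  { replace (fun s => Phi (tau (u_axis u0) (u_axis s)))
      with (fun s => phi (u_axis s)); [exact HG|].
    apply functional_extensionality; intros s; apply Hphi. }
  destruct (axis_jet Phi f g u0 x1 y1 x2 y2 H0
    (Haxis (fun p => fst (Phi p)) f rf Bf Hrf Hfexp f00)
    (Haxis (fun p => snd (Phi p)) g rg Bg Hrg Hgexp g00) HG')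
    as (HP & Hb & H02).
  apply (obstruction_vanishes f g c (x1, y1) (x2, y2)); try assumption.
  - intros Hf10. apply HP. rewrite R2, Hf10. apply C_ext; simpl; ring.
  - destruct HS as [-> ->]. apply C_ext; simpl; ring.
Qed.

End Local.

Theorem mainTheorem7
  (M : C * C -> Prop) (F : C -> R -> R)
  (a : nat -> nat -> nat -> C) (r : R)
  (r_pos : 0 < r)
  (F_expansion : power_series_expansion F a r)
  (M_graph : locally origin (fun p => M p <-> graph F p))
  (F_j0 : forall (j : nat) (u : R), Rabs u < r -> coef a j 0 u = RtoC 0)
  (F_0k : forall (k : nat) (u : R), Rabs u < r -> coef a 0 k u = RtoC 0)
  (F_j1 : forall (j : nat) (u : R), j <> 1%nat -> Rabs u < r ->
    coef a j 1 u = RtoC 0)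
  (F_1k : forall (k : nat) (u : R), k <> 1%nat -> Rabs u < r ->
    coef a 1 k u = RtoC 0)
  (F_11 : forall u : R, Rabs u < r -> coef a 1 1 u = RtoC 1)
  (F_22 : forall u : R, Rabs u < r -> coef a 2 2 u = RtoC 0)
  (eps : R) (eps_pos : 0 < eps)
  (axis_chain : moser_chain M u_axis (- eps) eps) :
  forall u : R, Rabs u < r -> coef a 3 2 u = RtoC 0 /\ coef a 2 3 u = RtoC 0.
Proof.
  destruct (normalized_expansion F a r r_pos F_expansion F_j0 F_0k F_j1 F_1k
              F_11 F_22) as [B HB].
  destruct (locally_Cmod _ _ M_graph) as (d & Hd & HM).
  pose proof (proj1 F_expansion) as Ha.
  assert (HM' : forall z w, Cmod z < d -> Cmod w < d ->
            M (z, w) <-> graph F (z, w)).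
  { intros z w Hz Hw. apply HM; simpl.
    - now replace (z - 0)%C with z by ring.
    - now replace (w - 0)%C with w by ring. }
  assert (Hnear : locally 0 (fun u => Rabs u < r /\ Rabs u < d /\ Rabs u < eps)).
  { apply filter_and; [now apply (near_0 r)|].
    apply filter_and; [now apply (near_0 d)|now apply (near_0 eps)]. }
  assert (H32 : locally 0 (fun u => coef a 3 2 u = RtoC 0)).
  { revert Hnear. apply filter_imp. intros u (H1 & H2 & H3).
    apply (coef_32_vanishes M F a r B d u r_pos Ha H1 HB HM' H2).
    apply axis_chain. apply Rabs_def2 in H3. lra. }
  assert (H23 : locally 0 (fun u => coef a 2 3 u = RtoC 0)).
  { generalize (filter_and _ _ Hnear H32). apply filter_imp.
    intros u [(H1 & _) H]. rewrite (coef_conj F a r B u r_pos Ha H1 HB), H.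
    apply Cconj_R. }
  intros u _. split; now apply (coef_identity_principle a r r_pos Ha).
Qed.
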